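(* Fix $t\in\mathbb N$ and let $\mathfrak{gl}^M$ be the Mackey Lie algebra of a diagonalizable pairing $V\otimes V_*\to\mathbb C$ with $\dim V=\aleph_t$. The following is a complete list of the nonzero proper ideals of $\mathfrak{gl}^M$: (i) the center $\mathbb C\,\mathrm{id}_V$; (ii) $\mathfrak{sl}(V,V_* )$; (iii) $\mathbb C\,\mathrm{id}_V\oplus\mathfrak{sl}(V,V_* )=\mathrm{soc}^1\mathfrak{gl}^M$; (iv) $\mathbb C(z\,\mathrm{id}_V+e_{b,b})+\mathfrak{sl}(V,V_* )\subset\mathrm{soc}^2\mathfrak{gl}^M$ for arbitrary $z\in\mathbb C\setminus\{0\}$ and $b\in\mathcal B$; this ideal depends only on $z$ and not on $b$; (v) $\mathfrak{gl}^M_s\subset\mathrm{soc}^{s+2}\mathfrak{gl}^M$ for $s=0,\dots,t$ (where $\mathfrak{gl}^M_0=\mathfrak{gl}(V,V_* )$); (vi) $\mathbb C\,\mathrm{id}_V\oplus\mathfrak{gl}^M_s=\mathrm{soc}^{s+2}\mathfrak{gl}^M$ for $s=0,\dots,t$.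
   Context: The ground field is $\mathbb C$, $\otimes=\otimes_{\mathbb C}$, $\mathbb N$ contains $0$. $V$ is a vector space with basis $\{v_b:b\in\mathcal B\}$, $|\mathcal B|=\aleph_t$; $V^*=\mathrm{Hom}(V,\mathbb C)$; $x_b\in V^*$ is defined by $x_b(v_a)=\delta_{ab}$; $V_*:=\mathrm{span}\{x_b:b\in\mathcal B\}\subset V^*$; $\mathbf p:V\otimes V_*\to\mathbb C$ is the evaluation pairing. The Mackey Lie algebra is $\mathfrak{gl}^M:=\{\varphi\in\mathrm{End}(V):\varphi^*(V_* )\subset V_*\}$ with the commutator bracket, where $\varphi^*$ is the dual endomorphism of $V^*$. $\mathfrak{gl}(V,V_* ):=V\otimes V_*\subset\mathfrak{gl}^M$ is the set of finite rank elements, with basis $e_{a,b}:=v_a\otimes x_b$ ($a,b\in\mathcal B$), and $\mathfrak{sl}(V,V_* ):=\ker\mathbf p$. Identify $V^*$ with $\mathrm{Maps}(\mathcal B,\mathbb C)$ via $x\mapsto(b\mapsto x(v_b))$; for $0\le s\le t+1$ let $V^*_s\subset V^*$ be the subspace of those $x$ whose support $\{b: x(v_b)\ne0\}$ has cardinality $<\aleph_s$. Set $\mathfrak{gl}^M_s:=\{\varphi\in\mathfrak{gl}^M:\varphi^*(V^* )\subset V^*_s\}$. $\mathrm{soc}^q\mathfrak{gl}^M$ denotes the socle filtration of the adjoint module: $\mathrm{soc}^1M$ is the largest semisimple submodule of $M$, and $\mathrm{soc}^qM$ is the preimage in $M$ of $\mathrm{soc}^1(M/\mathrm{soc}^{q-1}M)$.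 *)

(* Defs.v *)
From HB Require Import structures.
From mathcomp Require Import all_boot all_order all_algebra.
From mathcomp Require Import generic_quotient ring_quotient finmap.
From mathcomp Require Import complex.
From mathcomp Require Import all_classical all_reals.

Set Implicit Arguments.
Unset Strict Implicit.
Unset Printing Implicit Defensive.

Import GRing.Theory.

Local Open Scope classical_set_scope.
Local Open Scope ring_scope.
Local Open Scope quotient_scope.

Section Cardinals.
Local Open Scope card_scope.

Definition card_lt (T U : Type) (A : set T) (A' : set U) : Prop :=
  A #<= A' /\ ~ (A' #<= A).

(* |A| = aleph_n.  The cardinal aleph_(n+1) is the successor of aleph_n; as
   every cardinal below |A| is that of a subset of A, the quantifiers may
   range over subsets of A. *)
Fixpoint has_card_aleph (n : nat) (T : Type) (A : set T) : Prop :=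
  if n is n'.+1 then
    exists A' : set T,
      [/\ A' `<=` A, has_card_aleph n' A', card_lt A' A
        & ~ exists D : set T, [/\ D `<=` A, card_lt A' D & card_lt D A]]
  else A #= [set: nat].

Definition card_lt_aleph (T : Type) (S : set T) (n : nat) : Prop :=
  exists (U : Type) (A : set U), has_card_aleph n A /\ card_lt S A.

End Cardinals.

Section Subspaces.
Variables (K : pzRingType) (M : lmodType K).
Implicit Types (N S : set M) (u w : M).

Definition subspace N : Prop :=
  N 0 /\ forall (a : K) u w, N u -> N w -> N (a *: u + w).

Definition lspan S : set M := smallest subspace S.

Definition sumset N S : set M :=
  [set u | exists u1 u2, [/\ N u1, S u2 & u = u1 + u2]].

Definition line u : set M := [set a *: u | a in [set: K]].

Lemma subspace_span S : subspace (lspan S).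
Proof.
split=> [N [[N0 _] _] //|a u w Su Sw N [Nl SN]].
by apply: (proj2 Nl); [exact: Su | exact: Sw].
Qed.

Definition span_pred S : {pred M} := [pred u | u \in lspan S].

Lemma span_submod_closed S : submod_closed (span_pred S).
Proof.
have [S0 SD] := subspace_span S.
split=> [|a u w]; rewrite !inE //; exact: SD.
Qed.

HB.instance Definition _ S :=
  GRing.isSubmodClosed.Build K M (span_pred S) (span_submod_closed S).

(* The quotient M / N.  For a subspace N one has lspan N = N; going through
   the span makes the quotient total in the set N. *)
Definition quotmod N : Type := Quotient.quot (span_pred N).

HB.instance Definition _ N := Choice.on (quotmod N).
HB.instance Definition _ N := GRing.Zmodule.on (quotmod N).
HB.instance Definition _ N := Quotient.on (quotmod N).

Definition quot_proj N (u : M) : quotmod N := \pi_(quotmod N) u.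

Lemma quot_projP N u w :
  reflect (quot_proj N u = quot_proj N w) (u - w \in span_pred N).
Proof. by rewrite Quotient.idealrBE; apply: eqP. Qed.

Lemma quot_projD N : {morph @quot_proj N : u w / u + w}.
Proof.
move=> u w; rewrite /quot_proj.
exact: (raddfD \pi_(Quotient.quot (span_pred N))).
Qed.

Lemma quot_proj_repr N (q : quotmod N) : quot_proj N (repr q) = q.
Proof. exact: reprK. Qed.

Definition quot_scale N (a : K) (q : quotmod N) : quotmod N :=
  quot_proj N (a *: repr q).

Lemma quot_scale_proj N a u :
  quot_scale a (quot_proj N u) = quot_proj N (a *: u).
Proof.
apply/quot_projP; rewrite -scalerBr rpredZ //.
by apply/quot_projP; rewrite quot_proj_repr.
Qed.

Let scaleA N (a b : K) (q : quotmod N) :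
  quot_scale a (quot_scale b q) = quot_scale (a * b) q.
Proof. by rewrite -[q]quot_proj_repr !quot_scale_proj scalerA. Qed.

Let scale1 N : left_id 1 (@quot_scale N).
Proof. by move=> q; rewrite -[q]quot_proj_repr !quot_scale_proj scale1r. Qed.

Let scaleDr N : right_distributive (@quot_scale N) +%R.
Proof.
move=> a q r; rewrite -[q]quot_proj_repr -[r]quot_proj_repr.
by rewrite -quot_projD !quot_scale_proj -quot_projD scalerDr.
Qed.

Let scaleDl N (q : quotmod N) :
  {morph (@quot_scale N)^~ q : a b / a + b}.
Proof.
move=> a b; rewrite -[q]quot_proj_repr !quot_scale_proj -quot_projD.
by rewrite scalerDl.
Qed.

HB.instance Definition _ N := GRing.Zmodule_isLmodule.Build K (quotmod N)
  (@scaleA N) (@scale1 N) (@scaleDr N) (@scaleDl N).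

End Subspaces.

(* Submodules and socles only depend on the family of operators [act x], so
   they are stated for any such family on a vector space. *)
Section Socle.
Variables (K : pzRingType) (L : Type).

Section SocleOfModule.
Variables (M : lmodType K) (act : L -> M -> M).
Implicit Types N P : set M.

Definition submodule N : Prop :=
  subspace N /\ forall x u, N u -> N (act x u).

Definition simple_submodule N : Prop :=
  [/\ submodule N, N <> [set 0]
    & forall P, submodule P -> P `<=` N -> P = [set 0] \/ P = N].

Definition semisimple_submodule N : Prop :=
  submodule N /\
  N = lspan (\bigcup_(P in [set P | simple_submodule P /\ P `<=` N]) P).

(* The largest semisimple submodule, being semisimple and containing every
   semisimple submodule, is their union. *)
Definition socle : set M := \bigcup_(N in semisimple_submodule) N.

Definition quot_act N (x : L) (q : quotmod N) : quotmod N :=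
  quot_proj N (act x (repr q)).

End SocleOfModule.

Variables (M : lmodType K) (act : L -> M -> M).

(* soc^q, with the convention soc^0 = 0 *)
Fixpoint soc (q : nat) : set M :=
  if q is q'.+1 then
    if q' is 0%N then socle act
    else quot_proj (soc q') @^-1` socle (@quot_act M act (soc q'))
  else [set 0].

End Socle.

Lemma linear_comb (K : comPzRingType) (U W : lmodType K) (c : K)
    (f g : U -> W) :
  linear f -> linear g -> linear (c *: f + g).
Proof.
move=> lf lg a u w.
change (c *: f (a *: u + w) + g (a *: u + w)
        = a *: (c *: f u + g u) + (c *: f w + g w)).
by rewrite lf lg !scalerDr !scalerA [c * a]mulrC addrACA.
Qed.

Lemma linear_at0 (K : pzRingType) (U W : lmodType K) (f : U -> W) :
  linear f -> f 0 = 0.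
Proof. by move=> lf; have := lf (-1) 0 0; rewrite !scaleN1r !addNr. Qed.

Section Mackey.
Variables (K : fieldType) (B : choiceType) (V : lmodType K) (v : B -> V).

Definition is_basis : Prop :=
  forall w : V, exists! c : {fsfun B -> K with 0},
    w = \sum_(b <- finsupp c) c b *: v b.

(* V^*, as a subspace of the space of all functions V -> K *)
Definition dual_space : set (V -> K^o) := [set x | linear x].

Definition dual_endo (phi : V -> V) (x : V -> K^o) : V -> K^o := x \o phi.

(* x_b, which is unique when v is a basis *)
Definition coord_form (b : B) : V -> K^o :=
  xget (fun=> 0) [set x | dual_space x /\ forall a, x (v a) = (a == b)%:R].

(* V_* *)
Definition restricted_dual : set (V -> K^o) := lspan (range coord_form).

(* V^*_s *)
Definition dual_space_s (s : nat) : set (V -> K^o) :=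
  [set x | dual_space x /\ card_lt_aleph [set b | x (v b) != 0] s].

Definition mackey_pred : {pred V -> V} :=
  [pred phi | `[< linear phi /\
                  dual_endo phi @` restricted_dual `<=` restricted_dual >]].

Record glM := GlM { glM_fun :> V -> V; glM_funP : glM_fun \in mackey_pred }.

HB.instance Definition _ := [isSub for glM_fun].
HB.instance Definition _ := [Choice of glM by <:].

Lemma mackeyP (phi : V -> V) : reflect
  (linear phi /\ forall x, restricted_dual x -> restricted_dual (x \o phi))
  (phi \in mackey_pred).
Proof.
apply: (iffP (asboolP _)) => -[lphi H]; split=> //.
  by move=> x xV; apply: H; exists x.
by move=> _ [x xV <-]; exact: H.
Qed.

Lemma dual_space_subspace : subspace dual_space.
Proof.
split=> [a u w|c x y lx ly]; last exact: linear_comb.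
by rewrite /= scaler0 addr0.
Qed.

Lemma coord_form_linear b : dual_space (coord_form b).
Proof.
rewrite /coord_form; case: xgetP => [x _ [] //|_].
exact: (proj1 dual_space_subspace).
Qed.

Lemma restricted_dual_linear x : restricted_dual x -> linear x.
Proof.
apply: (smallest_sub dual_space_subspace) => _ [b _ <-].
exact: coord_form_linear.
Qed.

Lemma mackey_submod_closed : submod_closed mackey_pred.
Proof.
have [V0 VD] := subspace_span (range coord_form).
split=> [|c f g /mackeyP[lf Hf] /mackeyP[lg Hg]]; apply/mackeyP; split.
- by move=> a u w /=; rewrite scaler0 addr0.
- move=> x /restricted_dual_linear lx.
  suff -> : x \o (0 : V -> V) = (0 : V -> K^o) by [].
  by apply: funext => u /=; exact: linear_at0 lx.
- exact: linear_comb.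
- move=> x xV; have lx := restricted_dual_linear xV.
  have -> : x \o (c *: f + g) = c *: (x \o f) + (x \o g).
    by apply: funext => u /=; exact: lx.
  by apply: VD; [exact: Hf | exact: Hg].
Qed.

HB.instance Definition _ :=
  GRing.isSubmodClosed.Build K (V -> V) mackey_pred mackey_submod_closed.

HB.instance Definition _ := [SubChoice_isSubLmodule of glM by <:].

Lemma mackey_comp f g :
  f \in mackey_pred -> g \in mackey_pred -> f \o g \in mackey_pred.
Proof.
move=> /mackeyP[lf Hf] /mackeyP[lg Hg]; apply/mackeyP; split=> [a u w|x xV] /=.
  by rewrite lg lf.
exact: (Hg _ (Hf _ xV)).
Qed.

Lemma mackey_bracket (phi psi : glM) :
  (phi \o psi) - (psi \o phi) \in mackey_pred.
Proof. by rewrite rpredB // mackey_comp // glM_funP. Qed.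

Lemma mackey_id : idfun \in mackey_pred.
Proof. by apply/mackeyP; split. Qed.

Definition bracket (phi psi : glM) : glM := GlM (mackey_bracket phi psi).

Definition glM_id : glM := GlM mackey_id.

(* An element \sum_i w_i (x) y_i of V (x) V_* is given by a sequence of pairs
   (w_i, y_i).  Two sequences give the same tensor if and only if they give
   the same endomorphism [tensor_op]. *)
Definition tensor_op (s : seq (V * (V -> K^o))) : V -> V :=
  fun u => \sum_(p <- s) p.2 u *: p.1.

(* the evaluation pairing p *)
Definition tensor_ev (s : seq (V * (V -> K^o))) : K := \sum_(p <- s) p.2 p.1.

(* gl(V, V_* ) *)
Definition gl_fin : set glM :=
  [set phi | exists s, {in s, forall p, restricted_dual p.2} /\
                       phi = tensor_op s :> (V -> V)].

(* sl(V, V_* ) *)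
Definition sl_fin : set glM :=
  [set phi | exists s, [/\ {in s, forall p, restricted_dual p.2},
                           phi = tensor_op s :> (V -> V) & tensor_ev s = 0]].

Lemma mackey_unit (a b : B) :
  tensor_op [:: (v a, coord_form b)] \in mackey_pred.
Proof.
have opE u : tensor_op [:: (v a, coord_form b)] u = coord_form b u *: v a.
  by rewrite /tensor_op big_seq1.
apply/mackeyP; split=> [c u w|x xV].
  by rewrite !opE coord_form_linear scalerDl scalerA.
have [V0 VD] := subspace_span (range coord_form).
have lx := restricted_dual_linear xV.
have -> : x \o tensor_op [:: (v a, coord_form b)]
          = x (v a) *: coord_form b + 0.
  apply: funext => u /=; rewrite opE addr0.
  rewrite -[_ *: v a]addr0 lx (linear_at0 lx) addr0.
  exact: mulrC.
by apply: VD => //; apply: sub_gen_smallest; exists b.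
Qed.

(* e_(a,b) *)
Definition glM_unit (a b : B) : glM := GlM (mackey_unit a b).

(* gl^M_s *)
Definition glM_s (s : nat) : set glM :=
  [set phi | dual_endo phi @` dual_space `<=` dual_space_s s].

(* Ideals are the submodules of the adjoint module. *)
Definition is_ideal (I : set glM) : Prop := submodule bracket I.

Definition glM_center : set glM :=
  [set phi | forall psi, bracket psi phi = 0].

Definition scalars : set glM := line glM_id.

(* the ideal C (z id + e_(b,b)) + sl(V, V_* ) *)
Definition shifted_sl (z : K) (b : B) : set glM :=
  sumset (line (z *: glM_id + glM_unit b b)) sl_fin.

End Mackey.

Arguments bracket {K B V} v.
Arguments gl_fin {K B V} v _.
Arguments sl_fin {K B V} v _.
Arguments glM_s {K B V} v s _.
Arguments glM_center {K B V} v _.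
Arguments scalars {K B V} v _.
Arguments shifted_sl {K B V} v z b _.

(* Main.v *)
Require Import Defs.
From HB Require Import structures.
From mathcomp Require Import all_boot all_order all_algebra.
From mathcomp Require Import finmap complex.
From mathcomp Require Import all_classical all_reals.

(* The heart of the proof is Herstein's device: for an ideal I of gl^M, the set
   T of those x with [x, gl^M] in I is an associative subring that contains I,
   and a, b in T implies r [a, b] s in T for all r, s in gl^M.  If no translate
   phi - c id of an element phi of I is supported on fewer than aleph_s basis
   vectors, then phi, or its bracket with an involution exchanging eigenvectors
   of distinct eigenvalues,
     has aleph_s many nonzero off-diagonal entries that do
   not interact with one another, because rows and columns are finite.  A corner
   of it is then an element of I of square zero, and Herstein's device puts in T
   every operator supported on at most aleph_s basis vectors.  An Eilenberg
   swindle writes such operators as sums of brackets of elements of T with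
   elements of gl^M, so they lie in I; the same argument with a single entry
   gives sl(V, V_* ).  Hence the ideals not contained in the center lie between
   the members of the chain of the gl^M_s and of their sums with the scalars,
     and
   each quotient in the socle filtration has a unique minimal submodule. *)

Set Implicit Arguments.
Unset Strict Implicit.
Unset Printing Implicit Defensive.

Import GRing.Theory.

Local Open Scope classical_set_scope.
Local Open Scope ring_scope.

(** * Cardinal arithmetic *)

Section CardinalArithmetic.
Local Open Scope card_scope.

(** A Lie ideal gives no access to products. The ring T does: it can be enlarged by multiplication,
    and what remains is to return from T to I by writing an operator as a sum of brackets. Finite
    and infinite supports part at this return. Infinitely many disjoint copies of an infinite set
    leave room for the swindle, whereas on finite rank operators the trace is an obstruction and
    only its kernel is reached. The ideals of kind (iv) live in this gap: modulo sl, the sum of the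
    scalars and of the finite rank operators is a plane on which the adjoint action is zero, so
    every line in it gives an ideal. Sizes are measured by counting nonzero columns. Operators
    supported on at most aleph_s basis vectors are those supported on fewer than aleph_(s+1), which
    is why leaving one member of the chain forces the whole next member. Since rows and columns are
    finite, thinning a set of columns until they no longer interact loses at most a countable
    factor, so the cardinal arithmetic rests on the inequality Z * nat <= Z for infinite Z. The
    corner and the square-zero identity each produce a factor 2, which has to be inverted. *)

Lemma choice_on T U (A : set T) (r : T -> U -> Prop) (y0 : U) :
  (forall x, A x -> exists y, r x y) -> exists f, forall x, A x -> r x (f x).
Proof.
move=> rA; suff /choice[f fP] : forall x, exists y, A x -> r x y by exists f.
move=> x; have [/rA[y rxy]|nAx] := pselect (A x); first by exists y.
by exists y0.
Qed.

(** Only injectivity has to be checked for the relation; a function inside it comes from choice.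
    Codings defined by cases can thus be given as disjunctions. *)
Lemma rel_card_le T U (A : set T) (C : set U) (r : T -> U -> Prop) :
  (forall x, A x -> exists2 y, C y & r x y) ->
  (forall x x' y, A x -> A x' -> r x y -> r x' y -> x = x') -> A #<= C.
Proof.
move=> rA rI.
have [A0|/set0P[x0 Ax0]] := eqVneq A set0; first by rewrite A0.
have [y0 _ _] := rA _ Ax0.
have [f fP] : exists f : T -> U, forall x, A x -> C (f x) /\ r x (f x).
  apply: (choice_on (r := fun x y => C y /\ r x y) y0) => x /rA[y Cy rxy].
  by exists y.
have /injfunPex[g] : exists2 f : T -> U, set_fun A C f & set_inj A f.
  exists f => [x /fP[] //|x x' /set_mem Ax /set_mem Ax' e].
  by apply: (rI _ _ (f x)) => //; [case: (fP _ Ax)|rewrite e; case: (fP _ Ax')].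
exact: inj_card_le.
Qed.

Lemma fun_card_le T U (A : set T) (C : set U) (f : T -> U) :
  (forall x, A x -> C (f x)) ->
  (forall x x', A x -> A x' -> f x = f x' -> x = x') -> A #<= C.
Proof.
move=> fA fI; apply: (@rel_card_le _ _ _ _ (fun x y => f x = y)) => [x Ax|].
  by exists (f x) => //; exact: fA.
by move=> x x' y Ax Ax' <- /esym; exact: fI.
Qed.

(** Trades an injection between subtypes for a total function, with junk value [u0] outside A. *)
Lemma card_le_fun T U (A : set T) (C : set U) (u0 : U) : A #<= C ->
  exists f : T -> U, (forall x, A x -> C (f x)) /\
    (forall x x', A x -> A x' -> f x = f x' -> x = x').
Proof.
move=> /card_leP[f].
exists (fun x => if pselect (A x) is left Ax then val (f (SigSub (mem_set Ax)))
                 else u0); split=> [x|x x'].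
  by case: pselect => // Ax _; exact: set_valP.
move=> Ax Ax'; case: pselect => // Ax1; case: pselect => // Ax1' /val_inj.
by move=> /(@inj _ _ _ f) => /(_ (mem_set I) (mem_set I)) [].
Qed.

(* A maximal disjoint subcollection of the pairs of points of A and C exhausts
   one of these sets. *)
Lemma card_le_total T U (A : set T) (C : set U) : A #<= C \/ C #<= A.
Proof.
pose F (p : T * U) : set (T + U) := [set q | q = inl p.1 \/ q = inr p.2].
have [E [EAC tE maxE]] :=
  ex_maximal_disjoint_subcollection F (A `*` C).
have Einj p q s : E p -> E q -> F p s -> F q s -> p = q.
  by move=> Ep Eq Fp Fq; apply: tE => //; exists s.
have [EA|] := pselect (forall x, A x -> exists y, E (x, y)).
  left; apply: (@rel_card_le _ _ _ _ (fun x y => E (x, y))) => [x /EA[y Ey]|].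
    by exists y => //; have [] := EAC _ Ey.
  move=> x x' y _ _ Ex Ex'.
  suff [] : (x, y) = (x', y) by [].
  by apply: (Einj _ _ (inr y)) => //=; right.
have [EC|] := pselect (forall y, C y -> exists x, E (x, y)).
  right; apply: (@rel_card_le _ _ _ _ (fun y x => E (x, y))) => [y /EC[x Ex]|].
    by exists x => //; have [] := EAC _ Ex.
  move=> y y' x _ _ Ey Ey'.
  suff [] : (x, y) = (x, y') by [].
  by apply: (Einj _ _ (inl x)) => //=; left.
move=> /existsNP[y /not_implyP[Cy nEy]] /existsNP[x /not_implyP[Ax nEx]].
exfalso; apply: (maxE (E `|` [set (x, y)])).
- split=> [p|sub]; first by left.
  by apply: nEx; exists y; apply: sub; right.
- by move=> p [/EAC //|->].
- move=> p q [Ep|->] [Eq|->] // [s [Fp Fq]]; first exact: Einj Fp Fq.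
  + exfalso; case: p Ep Fp => a b Ep [] /= -> in Fq *; case: Fq => //= -[e].
    * by apply: nEx; exists b; rewrite -e.
    * by apply: nEy; exists a; rewrite -e.
  + exfalso; case: q Eq Fq => a b Eq [] /= -> in Fp *; case: Fp => //= -[e].
    * by apply: nEx; exists b; rewrite -e.
    * by apply: nEy; exists a; rewrite -e.
Qed.

Lemma card_ltE T U (A : set T) (C : set U) : card_lt A C <-> ~ (C #<= A).
Proof.
split=> [[]//|nCA]; split=> //.
by case: (card_le_total A C).
Qed.

Lemma card_leNlt T U (A : set T) (C : set U) : ~ card_lt A C <-> C #<= A.
Proof.
split=> [|CA]; last by case.
by move=> nAC; apply: contrapT => /card_ltE.
Qed.

(* Z is, up to a finite set, the disjoint union of a family E of ranges of
   sequences, so that Z = E * nat and Z * nat = E * nat * nat. *)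
Lemma infinite_setX_nat T (Z : set T) :
  infinite_set Z -> Z `*` [set: nat] #<= Z.
Proof.
move=> Zinf.
pose D := [set u : nat -> T | injective u /\ forall n, Z (u n)].
have [E [ED tE maxE]] :=
  ex_maximal_disjoint_subcollection (fun u : nat -> T => range u) D.
have Einj u w n m : E u -> E w -> u n = w m -> u = w /\ n = m.
  move=> Eu Ew e; suff uw : u = w.
    by split=> //; move: e; rewrite uw; apply: (proj1 (ED _ Ew)).
  by apply: tE => //; exists (u n); split; [exists n|exists m].
pose rest := Z `\` \bigcup_(u in E) range u.
have injD S : S `<=` Z -> infinite_set S ->
    exists u, D u /\ forall n, S (u n).
  move=> SZ /[dup] /infinite_setN0[t0 _] /infiniteP Sinf.
  have [u [uS uI]] := card_le_fun t0 Sinf.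
  exists u; split; last by move=> n; exact: uS.
  by split=> [n m|n]; [exact: uI | exact/SZ/uS].
(* An infinite remainder would contain the range of one more injective sequence, against maximality
   of E. *)
have restfin : finite_set rest.
  apply: contrapT => restinf.
  have [u [Du ur]] := injD _ (@subDsetl _ _ _) restinf.
  have nEu : ~ E u by move=> Eu; case: (ur 0) => _; apply; exists u.
  apply: (maxE (E `|` [set u])).
  - split=> [p|sub]; first by left.
    by apply: nEu; apply: sub; right.
  - by move=> p [/ED //|->].
  - move=> p q [Ep|->] [Eq|->] // [s [[n _ <-]]].
    + by move=> [m _ e]; case: (Einj _ _ _ _ Eq Ep e).
    + by move=> [m _ e]; case: (ur m) => _; case; exists p => //; exists n.
    + by move=> [m _ e]; case: (ur n) => _; case; exists q => //; exists m.
have [u0 Eu0] : E !=set0.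
  apply: contrapT => E0; apply: Zinf; apply: sub_finite_set restfin => t Zt.
  by split=> // -[u Eu]; case: E0; exists u.
have [k [_ kI]] : exists f : T -> nat, (forall x, rest x -> setT (f x)) /\
    (forall x x', rest x -> rest x' -> f x = f x' -> x = x').
  exact/(card_le_fun 0)/finite_set_countable.
have [h hI] : exists h : nat * nat * bool -> nat, injective h.
  have /pcard_injP[h hI] := countableP [set: nat * nat * bool].
  by exists h => p q; apply: hI; exact: in_setT.
(* The finite remainder is put on the branch [false] of u0. *)
apply: (@rel_card_le _ _ _ _ (fun p y =>
  (exists u n, [/\ E u, p.1 = u n & y = u (h (n, p.2, true))]) \/
  (rest p.1 /\ y = u0 (h (k p.1, p.2, false))))) => [[t n] [/= Zt _]|].
  have [[u Eu [m _ utm]]|nt] := pselect ((\bigcup_(u in E) range u) t).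
    exists (u (h (m, n, true))); first exact: (proj2 (ED _ Eu)).
    by left; exists u, m.
  exists (u0 (h (k t, n, false))); first exact: (proj2 (ED _ Eu0)).
  by right.
move=> [t n] [t' n'] y _ _ /=.
move=> [[u [m [Eu -> ->]]]|[rt ->]] [[u' [m' [Eu' -> ]]]|[rt']] e.
- by have [-> /hI[-> ->]] := Einj _ _ _ _ Eu Eu' e.
- by have [_ /hI[]] := Einj _ _ _ _ Eu Eu0 e.
- by have [_ /hI[]] := Einj _ _ _ _ Eu0 Eu' e.
- by have [_ /hI[/(kI _ _ rt rt') -> ->]] := Einj _ _ _ _ Eu0 Eu0 e.
Qed.

(** A point of F i is coded by the image of i in Z and its number within F i. The sets may overlap,
    since a point is free to use any of its codes. *)
Lemma bigcup_card_le I T U (Z : set U) (D : set I) (F : I -> set T) :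
  infinite_set Z -> D #<= Z -> (forall i, D i -> countable (F i)) ->
  \bigcup_(i in D) F i #<= Z.
Proof.
move=> Zinf DZ Fc; apply: card_le_trans (infinite_setX_nat Zinf).
have [u0 _] := infinite_setN0 Zinf.
have [f [fZ fI]] := card_le_fun u0 DZ.
have {Fc} [k kI] : exists k : I -> T -> nat,
    forall i, D i -> forall x y, F i x -> F i y -> k i x = k i y -> x = y.
  apply: (choice_on (r := fun i k =>
    forall x y, F i x -> F i y -> k x = k y -> x = y) (fun=> 0)) => i Di.
  by have [k [_ kI]] := card_le_fun 0 (Fc _ Di); exists k.
apply: (@rel_card_le _ _ _ _ (fun x p =>
  exists i, [/\ D i, F i x, p.1 = f i & p.2 = k i x])) => [x [i Di Fix]|].
  by exists (f i, k i x) => /=; [split=> //; exact: fZ|exists i].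
move=> x x' p _ _ [i [Di Fx -> ->]] [i' [Di' Fx' /(fI _ _ Di Di') ii' ]].
by subst i'; exact: kI.
Qed.

Lemma setU_card_le T U (Z : set U) (A A' : set T) :
  infinite_set Z -> A #<= Z -> A' #<= Z -> A `|` A' #<= Z.
Proof.
move=> Zinf AZ A'Z; apply: card_le_trans (infinite_setX_nat Zinf).
have [u0 _] := infinite_setN0 Zinf.
have [f [fZ fI]] := card_le_fun u0 AZ.
have [f' [fZ' fI']] := card_le_fun u0 A'Z.
apply: (@rel_card_le _ _ _ _ (fun x p => (A x /\ p = (f x, 0)) \/
   (A' x /\ p = (f' x, 1)))) => [x [Ax|A'x]|].
- by exists (f x, 0); [split=> //; exact: fZ|left].
- by exists (f' x, 1); [split=> //; exact: fZ'|right].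
move=> x x' p _ _ [[Ax ->]|[Ax ->]] [[Ax' e]|[Ax' e]]; case: e => //.
  exact: fI.
exact: fI'.
Qed.

Lemma card_le_infinite T U (A : set T) (C : set U) :
  A #<= C -> infinite_set A -> infinite_set C.
Proof. by move=> AC Ainf /(card_le_finite AC). Qed.

End CardinalArithmetic.

(** * Uniqueness and comparison of alephs *)

Section Alephs.
Local Open Scope card_scope.

Lemma card_lt_eqr T T' U (S : set U) (A : set T) (A' : set T') :
  A #= A' -> card_lt S A <-> card_lt S A'.
Proof. by move=> e; rewrite !card_ltE (card_le_eql e). Qed.

Lemma card_lt_eql T T' U (S : set U) (A : set T) (A' : set T') :
  A #= A' -> card_lt A S <-> card_lt A' S.
Proof. by move=> e; rewrite !card_ltE (card_le_eqr e). Qed.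

Lemma card_le_sub T U (A : set T) (C : set U) :
  A #<= C -> exists2 D : set U, D `<=` C & D #= A.
Proof.
have [->|/set0P[x0 Ax0]] := eqVneq A set0.
  by exists set0 => //; exact: card_eq00.
move=> AC; have [u0 _] : exists u0 : U, True.
  have /card_leP[f] := AC.
  by exists (val (f (SigSub (mem_set Ax0)))).
have [f [fC fI]] := card_le_fun u0 AC.
exists (f @` A); first by move=> _ [x Ax <-]; exact: fC.
by apply: inj_card_eq => x y /set_mem Ax /set_mem Ay; exact: fI.
Qed.

Lemma aleph_infinite n T (A : set T) : has_card_aleph n A -> infinite_set A.
Proof.
elim: n T A => [|n IHn] T A /=.
  by move=> An; rewrite /not (eq_finite_set An); exact: infinite_nat.
by move=> [A' [A'A /IHn A'inf _ _]]; exact: sub_infinite_set A'A A'inf.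
Qed.

(** If C were smaller than A, a copy of C inside A would lie strictly between A and its predecessor
    A', which the successor clause excludes. *)
Lemma aleph_unique n T U (A : set T) (C : set U) :
  has_card_aleph n A -> has_card_aleph n C -> A #= C.
Proof.
suff le T' U' (A' : set T') (C' : set U') :
    has_card_aleph n A' -> has_card_aleph n C' -> A' #<= C'.
  by move=> An Cn; rewrite card_eqPle; split; exact: le.
elim: n T' U' A' C' {A C T U} => [|n IHn] T U A C /=.
  by move=> An Cn; rewrite (card_le_eql An) (card_le_eqr Cn) card_lexx.
move=> [A' [A'A alA' ltA' nD]] [C' [C'C alC' ltC' _]].
apply/card_leNlt => ltCA; apply: nD.
have [D DA eD] : exists2 D : set T, D `<=` A & D #= C.
  by apply: card_le_sub; case: ltCA.
exists D; split=> //; last exact/(card_lt_eql _ eD).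
apply/(card_lt_eqr _ eD)/card_ltE => CA'; apply: (card_ltE _ _).1 ltC' _.
exact: card_le_trans CA' (IHn _ _ _ _ alA' alC').
Qed.

Lemma aleph_sub s n T (A : set T) : (s <= n)%N ->
  has_card_aleph n A -> exists2 D : set T, D `<=` A & has_card_aleph s D.
Proof.
elim: n A => [|n IHn] A; first by rewrite leqn0 => /eqP -> An; exists A.
rewrite leq_eqVlt => /predU1P[-> An|]; first by exists A.
rewrite ltnS => sn [A' [A'A An _ _]].
by have [D DA' Ds] := IHn _ sn An; exists D => //; exact: subset_trans A'A.
Qed.

(** [card_lt_aleph] quantifies over all sets of cardinality aleph_s; by uniqueness any one of them
    decides. *)
Lemma card_lt_alephE s T U (A : set T) (S : set U) :
  has_card_aleph s A -> card_lt_aleph S s <-> ~ (A #<= S).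
Proof.
move=> As; rewrite -card_ltE; split=> [[U' [A' [As' ltS]]]|ltS].
  exact/(card_lt_eqr _ (aleph_unique As' As)).
by exists T, A.
Qed.

(** This is where aleph_(s+1) acts as a successor: bounds by aleph_s produced by the constructions
    become membership in the next member of the chain. *)
Lemma card_le_alephE s T U (A C : set T) (S : set U) :
  has_card_aleph s A -> has_card_aleph s.+1 C ->
  S #<= A <-> card_lt_aleph S s.+1.
Proof.
move=> As Cs; rewrite (card_lt_alephE _ Cs).
move: Cs => [A' [A'C As' ltA' nD]].
rewrite (card_le_eqr (aleph_unique As As')); split=> [SA' CS|nCS].
  by apply: (card_ltE _ _).1 ltA' _; exact: card_le_trans SA'.
apply/card_leNlt => ltA'S; apply: nD.
have [D DC eD] : exists2 D : set T, D `<=` C & D #= S.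
  by apply: card_le_sub; case: (card_le_total S C).
exists D; split=> //; first exact/(card_lt_eqr _ eD).
by apply/(card_lt_eql _ eD)/card_ltE.
Qed.

Lemma card_lt_aleph0 T (S : set T) : card_lt_aleph S 0 <-> finite_set S.
Proof.
rewrite (@card_lt_alephE 0 _ _ [set: nat]); last exact: card_eqxx.
rewrite -infiniteP; split=> [|Sfin]; first exact: contrapT.
by case.
Qed.

End Alephs.

(** * Coordinates *)

Section Subspaces.
Variables (K : pzRingType) (M : lmodType K) (N : set M).
Hypothesis subN : subspace N.

Lemma subspace0 : N 0. Proof. by case: subN. Qed.

Lemma subspaceD u w : N u -> N w -> N (u + w).
Proof. by move=> Nu Nw; rewrite -[u]scale1r; apply: (proj2 subN). Qed.

Lemma subspaceZ a u : N u -> N (a *: u).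
Proof.
by move=> Nu; rewrite -[_ *: _]addr0; apply: (proj2 subN) => //; exact:
  subspace0.
Qed.

Lemma subspaceN u : N u -> N (- u).
Proof. by move=> Nu; rewrite -scaleN1r; exact: subspaceZ. Qed.

Lemma subspaceB u w : N u -> N w -> N (u - w).
Proof. by move=> Nu Nw; apply: subspaceD => //; exact: subspaceN. Qed.

Lemma subspace_sum I (r : seq I) (P : pred I) (F : I -> M) :
  (forall i, P i -> N (F i)) -> N (\sum_(i <- r | P i) F i).
Proof. by move=> NF; apply: big_ind => //; [exact: subspace0|exact: subspaceD].
  Qed.

Lemma span_subspace : lspan N = N.
Proof. by apply/seteqP; split; [exact: smallest_sub|exact: sub_gen_smallest].
  Qed.

End Subspaces.

Lemma linear_comb_sum (K : pzRingType) (U W : lmodType K) (f : U -> W) I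
    (r : seq I) (c : I -> K) (w : I -> U) : linear f ->
  f (\sum_(i <- r) c i *: w i) = \sum_(i <- r) c i *: f (w i).
Proof.
move=> lf; elim: r => [|i r IHr]; first by rewrite !big_nil (linear_at0 lf).
by rewrite !big_cons lf IHr.
Qed.

Section Coordinates.
Variables (K : fieldType) (B : choiceType) (V : lmodType K) (v : B -> V).

HB.instance Definition _ b :=
  GRing.isLinear.Build K V K^o _ (coord_form v b) (@coord_form_linear _ _ _ v
    b).

Lemma glM_linear (phi : glM v) : linear phi.
Proof. by have /mackeyP[] := glM_funP phi. Qed.

HB.instance Definition _ (phi : glM v) :=
  GRing.isLinear.Build K V V _ (glM_fun phi) (glM_linear phi).

Hypothesis v_basis : is_basis v.

Let coef w : {fsfun B -> K with 0} := projT1 (cid (v_basis w)).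

Let coefE w : w = \sum_(b <- finsupp (coef w)) coef w b *: v b.
Proof. by rewrite /coef; case: cid => c []. Qed.

Let coef_uniq w c : w = \sum_(b <- finsupp c) c b *: v b -> coef w = c.
Proof. by move=> wE; rewrite /coef; case: cid => c' /= [_ uc']; exact: uc'. Qed.

Let sum_supp (W : lmodType K) (c : {fsfun B -> K with 0}) (A : {fset B})
    (m : B -> W) : (finsupp c `<=` A)%fset ->
  \sum_(b <- finsupp c) c b *: m b = \sum_(b <- A) c b *: m b.
Proof.
move=> cA; apply: big_fset_incl => // b _ bc.
by rewrite (fsfun_dflt bc) scale0r.
Qed.

(** The expansion may run over any finite set A and have zero coefficients, which spares computing
    the exact support of a sum. *)
Let coef_of_fset w (A : {fset B}) (c : B -> K) :
  w = \sum_(b <- A) c b *: v b ->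
  forall b, coef w b = if b \in A then c b else 0.
Proof.
move=> wE b; pose c' : {fsfun B -> K with 0} := [fsfun b in A => c b].
rewrite (@coef_uniq _ c') ?fsfunE //.
rewrite wE (@sum_supp _ _ A); last exact: finsupp_sub.
by apply: eq_fbigr => i iA _; rewrite fsfunE iA.
Qed.

Let coef_linear b : linear (fun w => coef w b : K^o).
Proof.
move=> a u w; pose A := (finsupp (coef u) `|` finsupp (coef w))%fset.
pose c i := a * coef u i + coef w i.
rewrite (@coef_of_fset _ A c).
  rewrite /c; case: ifP => // /negbT; rewrite inE negb_or => /andP[bu bw].
  by rewrite (fsfun_dflt bu) (fsfun_dflt bw) scaler0 addr0.
rewrite [in LHS](coefE u) [in LHS](coefE w).
rewrite (@sum_supp _ _ A) ?fsubsetUl // (@sum_supp _ (coef w) A) ?fsubsetUr //.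
rewrite scaler_sumr -big_split /=; apply: eq_bigr => i _.
by rewrite scalerA -scalerDl.
Qed.

Let coef_basis a b : coef (v a) b = (a == b)%:R.
Proof.
rewrite (@coef_of_fset _ [fset a]%fset (fun=> 1)).
  by rewrite inE eq_sym; case: eqP.
by rewrite big_seq_fset1 scale1r.
Qed.

Lemma lin_eq (W : lmodType K) (f g : V -> W) :
  linear f -> linear g -> (forall b, f (v b) = g (v b)) -> f = g.
Proof.
move=> lf lg fg; apply: funext => w.
rewrite (coefE w) !linear_comb_sum //.
by apply: eq_bigr => b _; rewrite fg.
Qed.

(** [coord_form] is a choice among functionals with prescribed values on the basis; the coefficient
    functional is one of them, and linearity makes it the only one. *)
Lemma coord_formE b w : coord_form v b w = coef w b.
Proof.
rewrite /coord_form; case: xgetP => [x _ [lx xv]|/(_ (coef^~ b))].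
  have : x = fun w => coef w b; last by move->.
  by apply: lin_eq => // a; rewrite xv coef_basis.
by case; split=> [|a]; [exact: coef_linear | exact: coef_basis].
Qed.

Lemma coord_form_basis a b : coord_form v b (v a) = (a == b)%:R.
Proof. by rewrite coord_formE coef_basis. Qed.

Lemma finite_coord w : finite_set [set b | coord_form v b w != 0].
Proof.
apply: (@sub_finite_set _ _ [set` finsupp (coef w)]); last exact: finite_fset.
by move=> b /=; rewrite coord_formE mem_finsupp.
Qed.

Lemma coord_sum w (A : {fset B}) :
  (forall b, coord_form v b w != 0 -> b \in A) ->
  w = \sum_(b <- A) coord_form v b w *: v b.
Proof.
move=> wA; rewrite {1}(coefE w) (@sum_supp _ _ A).
  by apply: eq_bigr => b _; rewrite coord_formE.
by apply/fsubsetP => b; rewrite mem_finsupp -coord_formE; exact: wA.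
Qed.

Lemma coord_ext w w' :
  (forall b, coord_form v b w = coord_form v b w') -> w = w'.
Proof.
move=> ww'; rewrite (coefE w) (coefE w').
suff -> : coef w = coef w' by [].
by apply/fsfunP => b; rewrite -!coord_formE.
Qed.

Lemma lin_ext (W : lmodType K) (m : B -> W) :
  exists f : V -> W, linear f /\ forall b, f (v b) = m b.
Proof.
exists (fun w => \sum_(b <- finsupp (coef w)) coef w b *: m b); split.
  move=> a u w.
  pose A := (finsupp (coef u) `|` finsupp (coef w) `|`
             finsupp (coef (a *: u + w)))%fset.
  rewrite (@sum_supp _ _ A) ?fsubsetUr // (@sum_supp _ (coef u) A); last first.
    by rewrite /A -fsetUA fsubsetUl.
  rewrite (@sum_supp _ (coef w) A); last first.
    by rewrite /A [X in (X `|` _)%fset]fsetUC -fsetUA fsubsetUl.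
  rewrite scaler_sumr -big_split /=; apply: eq_bigr => b _.
  by rewrite coef_linear scalerA -scalerDl.
move=> b; rewrite (@sum_supp _ _ [fset b]%fset).
  by rewrite big_seq_fset1 coef_basis eqxx scale1r.
apply/fsubsetP => a; rewrite mem_finsupp coef_basis inE.
by have [|] := eqVneq b a; rewrite ?eqxx.
Qed.

(** Turns the span into a condition on supports. Conversely, a functional of finite support is the
    sum of its values times the coordinate forms. *)
Lemma restricted_dualP x : restricted_dual v x <->
  linear x /\ finite_set [set b | x (v b) != 0].
Proof.
split=> [rx|[lx xfin]].
  split; first exact: (restricted_dual_linear rx).
  have sub : subspace [set x : V -> K^o | finite_set [set b | x (v b) != 0]].
    split=> [|a u w fu fw] /=.
      rewrite [X in finite_set X](_ : _ = set0) //.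
      by apply/seteqP; split=> b //=; rewrite eqxx.
    apply: (@sub_finite_set _ _
      ([set b | u (v b) != 0] `|` [set b | w (v b) != 0])).
      move=> b /=; have [ub|] := eqVneq (u (v b)) 0; last by left.
      have [wb|] := eqVneq (w (v b)) 0; last by right.
      have -> : (a *: u + w) (v b) = a *: u (v b) + w (v b) by [].
      by rewrite ub wb scaler0 addr0 eqxx.
    by rewrite finite_setU.
  move: x rx; apply: (smallest_sub sub) => _ [b _ <-] /=.
  apply: (@sub_finite_set _ _ [set b]); last exact: finite_set1.
  by move=> a /=; rewrite coord_form_basis; have [//|] := eqVneq a b;
    rewrite eqxx.
have sub := subspace_span (range (coord_form v)).
pose A := fset_set [set b | x (v b) != 0].
have -> : x = \sum_(b <- A) x (v b) *: coord_form v b.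
  apply: lin_eq => //.
    (* Only recasts the goal from linearity to membership in [dual_space], so that its closure
       properties apply. *)
    apply: (proj1 (conj (_ : dual_space _) I)).
    apply: (subspace_sum (@dual_space_subspace K V)) => b _.
    by apply: (subspaceZ (@dual_space_subspace K V)); exact: coord_form_linear.
  move=> a.
  have -> : (\sum_(b <- A) x (v b) *: coord_form v b) (v a) =
            \sum_(b <- A) x (v b) * (a == b)%:R.
    elim/big_ind2: _ => // [f c g d fc gd|b _].
      by rewrite -fc -gd.
    by rewrite -coord_form_basis.
  have [xa|xa] := eqVneq (x (v a)) 0.
    rewrite xa big1_fset // => b _ _.
    by have [<-|_] := eqVneq a b; rewrite ?xa ?mul0r ?mulr0.
  have aA : a \in A by rewrite in_fset_set // inE.
  rewrite (big_fsetD1 a) //= eqxx mulr1 big1_fset ?addr0 // => b.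
  by rewrite !inE eq_sym => /andP[/negPf -> _] _; rewrite mulr0.
apply: (subspace_sum sub) => b _; apply: (subspaceZ sub).
by apply: sub_gen_smallest; exists b.
Qed.

Lemma finite_col (phi : glM v) b :
  finite_set [set a | coord_form v a (phi (v b)) != 0].
Proof. exact: finite_coord. Qed.

(** Row a is the functional [coord_form v a] composed with phi, which the Mackey condition keeps in
    the restricted dual. *)
Lemma finite_row (phi : glM v) a :
  finite_set [set b | coord_form v a (phi (v b)) != 0].
Proof.
have /mackeyP[_ /(_ (coord_form v a))] := glM_funP phi.
have ra : restricted_dual v (coord_form v a).
  by apply: sub_gen_smallest; exists a.
by move=> /(_ ra) /restricted_dualP[].
Qed.

(** Every operator below is built from its matrix through this lemma. Columns are finite because
    they are vectors of V, so only rows need a check. *)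
Lemma glM_of_cols (m : B -> V) :
  (forall a, finite_set [set b | coord_form v a (m b) != 0]) ->
  exists phi : glM v, forall b, phi (v b) = m b.
Proof.
move=> mfin; have [f [lf fE]] := lin_ext m.
suff fP : f \in mackey_pred v by exists (GlM fP).
apply/mackeyP; split=> // x rx.
have sub : subspace [set x : V -> K^o | restricted_dual v x /\
                                  restricted_dual v (x \o f)].
  have sp := subspace_span (range (coord_form v)).
  split=> [|a u w [ru rfu] [rw rfw]]; first by split; exact: (subspace0 sp).
  by split; apply: (proj2 sp).
suff : [set x : V -> K^o | restricted_dual v x /\
                                  restricted_dual v (x \o f)] x by case.
move: x rx; apply: (smallest_sub sub) => _ [a _ <-]; split.
  by apply: sub_gen_smallest; exists a.
apply/restricted_dualP; split=> [c u w|].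
  by rewrite /= lf linearP.
apply: sub_finite_set (mfin a) => b /=.
by rewrite fE.
Qed.

Lemma glM_ext (phi psi : glM v) :
  (forall b, phi (v b) = psi (v b)) -> phi = psi.
Proof.
move=> e; apply: val_inj; apply: lin_eq => //; exact: glM_linear.
Qed.

End Coordinates.

(** * Supports of Mackey operators *)

Section AssociativeStructure.
Variables (K : fieldType) (B : choiceType) (V : lmodType K) (v : B -> V).

Definition glM_mul (phi psi : glM v) : glM v :=
  GlM (mackey_comp (glM_funP phi) (glM_funP psi)).

Let mulA : associative glM_mul.
Proof. by move=> f g h; apply: val_inj. Qed.

Let mul1 : left_id (glM_id v) glM_mul.
Proof. by move=> f; apply: val_inj. Qed.

Let mulr1' : right_id (glM_id v) glM_mul.
Proof. by move=> f; apply: val_inj. Qed.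

Let mulDl : left_distributive glM_mul +%R.
Proof. by move=> f g h; apply: val_inj. Qed.

Let mulDr : right_distributive glM_mul +%R.
Proof. by move=> f g h; apply: val_inj; apply: funext => w; exact: (linearD f).
  Qed.

HB.instance Definition _ :=
  GRing.Zmodule_isPzRing.Build (glM v) mulA mul1 mulr1' mulDl mulDr.

Lemma glM_mulE (f g : glM v) w : (f * g) w = f (g w). Proof. by []. Qed.

Lemma glM_scaleE a (f : glM v) w : (a *: f) w = a *: f w. Proof. by []. Qed.

Lemma glM_addE (f g : glM v) w : (f + g) w = f w + g w. Proof. by []. Qed.

Lemma glM_subE (f g : glM v) w : (f - g) w = f w - g w. Proof. by []. Qed.

Lemma bracketE (f g : glM v) : bracket v f g = f * g - g * f.
Proof. exact: val_inj. Qed.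

End AssociativeStructure.

Section Supports.
Variables (K : fieldType) (B : choiceType) (V : lmodType K) (v : B -> V).
Hypothesis v_basis : is_basis v.
Implicit Types (phi : glM v) (Z : set B).
Local Notation x_ := (coord_form v).

(** The indices of the nonzero columns; [glM_sP] shows that their number decides membership in
    [glM_s]. *)
Definition supp phi : set B := [set b | phi (v b) != 0].

Lemma suppN phi b : ~ supp phi b -> phi (v b) = 0.
Proof. by move=> /negP; rewrite negbK => /eqP. Qed.

(** A closed ball of radius 1 in the graph that joins two indices when one of the two matrix entries
    between them is nonzero. Including the centre lets disjointness of balls also exclude edges
    between centres. *)
Definition adj phi (a : B) : set B :=
  [set b | [\/ a = b, x_ a (phi (v b)) != 0 | x_ b (phi (v a)) != 0]].

Lemma adjC phi a b : adj phi a b -> adj phi b a.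
Proof.
by case=> [->|ab|ba]; [constructor 1|constructor 3|constructor 2].
Qed.

Lemma finite_adj phi a : finite_set (adj phi a).
Proof.
apply: (@sub_finite_set _ _ ([set a] `|` ([set b | x_ a (phi (v b)) != 0] `|`
    [set b | x_ b (phi (v a)) != 0]))).
  by move=> b [->|ab|ba]; [left|right; left|right; right].
rewrite !finite_setU; split; first exact: finite_set1.
by split; [exact: finite_row|exact: finite_col].
Qed.

(* Z is chosen so that the balls of radius 1 around its points, for the locally
   finite graph [adj phi], form a maximal disjoint subcollection; then the balls
   of radius 2 around Z cover O. *)
Lemma sparse_subset phi (O : set B) :
  exists Z, [/\ Z `<=` O, O !=set0 -> Z !=set0,
    infinite_set O -> (O #<= Z)%card &
    forall i j k, Z i -> Z j -> adj phi i k -> adj phi j k -> i = j].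
Proof.
have [Z [ZO tZ maxZ]] := ex_maximal_disjoint_subcollection (adj phi) O.
pose ball2 i := \bigcup_(k in adj phi i) adj phi k.
have Ocov : O `<=` \bigcup_(i in Z) ball2 i.
  move=> b Ob; apply: contrapT => nb.
  have far i k : Z i -> adj phi i k -> adj phi b k -> False.
    by move=> Zi ik bk; apply: nb; exists i => //; exists k => //; exact: adjC.
  have nZb : ~ Z b by move=> Zb; apply: (far b b) => //; constructor 1.
  apply: (maxZ (Z `|` [set b])).
  - split=> [p|sub]; first by left.
    by apply: nZb; apply: sub; right.
  - by move=> p [/ZO //|->].
  - move=> p q [Zp|->] [Zq|->] // [s [Fp Fq]].
    + by apply: tZ => //; exists s.
    + by case: (far _ _ Zp Fp Fq).
    + by case: (far _ _ Zq Fq Fp).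
have ballfin i : finite_set (ball2 i).
  by apply: bigcup_finite => [|k _]; exact: finite_adj.
exists Z; split=> //.
- by move=> [b /Ocov[i Zi _]]; exists i.
- move=> Oinf; have Zinf : infinite_set Z.
    move=> Zfin; apply: Oinf; apply: sub_finite_set Ocov _.
    exact: bigcup_finite.
  apply: card_le_trans (subset_card_le Ocov) _.
  by apply: bigcup_card_le => // i _; exact: finite_set_countable.
- by move=> i j k Zi Zj ik jk; apply: tZ => //; exists k.
Qed.

Lemma supp_coord phi b : supp phi b -> exists a, x_ a (phi (v b)) != 0.
Proof.
move=> sb; apply: contrapT => /forallNP na; move/negP: sb; apply.
apply/eqP; apply: (coord_ext v_basis) => a; rewrite linear0.
by apply/eqP; have /negP := na a; rewrite negbK.
Qed.

(** Choose a nonzero entry in each column of a sparse set Z and let x be the indicator of the chosen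
    rows. Sparsity keeps a chosen row out of the other columns of Z, so no cancellation occurs and x
    sees every column in Z. *)
Lemma dual_large phi : infinite_set (supp phi) ->
  exists2 x, dual_space x & (supp phi #<= [set b | x (phi (v b)) != 0])%card.
Proof.
move=> sinf; have [Z [Zs _ Zle Zsp]] := sparse_subset phi (supp phi).
have [b0 _] := infinite_setN0 sinf.
have [g gP] : exists g, forall b, Z b -> x_ (g b) (phi (v b)) != 0.
  by apply: (choice_on (r := fun b a => x_ a (phi (v b)) != 0) b0) =>
    b /Zs /supp_coord.
have [x [lx xE]] :=
  lin_ext v_basis (fun a => (`[< exists2 i, Z i & a = g i >])%:R : K^o).
exists x => //; apply: card_le_trans (Zle sinf) _.
apply: subset_card_le => b Zb /=.
have /finite_fsetP[fin_b /seteqP[fb _]] := finite_col v_basis phi b.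
rewrite (coord_sum v_basis (A := fin_b) (w := phi (v b))); last first.
  by move=> a; exact: fb.
rewrite (linear_comb_sum _ _ _ lx).
have gb : g b \in fin_b by apply: fb; exact: gP.
rewrite (big_fsetD1 (g b)) //= big1_fset ?addr0.
  rewrite xE (_ : `[< _ >] = true); last by apply/asboolP; exists b.
  by rewrite scaler_eq0 negb_or gP // oner_eq0.
move=> a; rewrite !inE => /andP[ab _] _.
rewrite xE; case: asboolP => [[i Zi ai]|_]; last by rewrite scaler0.
have [->|/eqP xa] := eqVneq (x_ a (phi (v b))) 0; first by rewrite scale0r.
suff ib : i = b by rewrite ai ib eqxx in ab.
apply: (Zsp _ _ a) => //; constructor 3 => //; first by rewrite ai; exact: gP.
exact/eqP.
Qed.

(** The definition tests all functionals one at a time; by [dual_large] a single one already detects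
    a support that is too large. *)
Lemma glM_sP s (A : set B) phi : has_card_aleph s A ->
  glM_s v s phi <-> card_lt_aleph (supp phi) s.
Proof.
move=> As; split=> [sphi|sphi].
  apply/(card_lt_alephE _ As) => le.
  have [x dx xle] := dual_large (card_le_infinite le (aleph_infinite As)).
  have [_ /(card_lt_alephE _ As)] : dual_space_s v s (x \o phi).
    by apply: sphi; exists x.
  by apply; exact: card_le_trans xle.
move=> _ [x lx <-]; split; first by move=> a u w;
  rewrite /dual_endo /= linearP lx.
apply/(card_lt_alephE _ As) => le; move/(card_lt_alephE _ As): sphi; apply.
apply: card_le_trans le _; apply: subset_card_le => b /=.
rewrite /dual_endo /=; apply: contra_neq => ->; exact: linear_at0.
Qed.

End Supports.

(** * Ideals containing large operators *)

Section Herstein.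
Variables (R : pzRingType) (I : set R).
Local Notation com x y := (x * y - y * x).
Hypothesis IB : forall x y, I x -> I y -> I (x - y).
Hypothesis Icom : forall x y, I x -> I (com x y).

(** Herstein's ring T of elements whose brackets with everything lie in I. *)
Definition absorbed : set R := [set x | forall r, I (com x r)].

Lemma absorbed_ideal x : I x -> absorbed x.
Proof. by move=> Ix r; exact: Icom. Qed.

Let I0 x : I x -> I 0. Proof. by move=> Ix; rewrite -(subrr x); exact: IB. Qed.

Let IN x : I x -> I (- x).
Proof. by move=> Ix; rewrite -sub0r; apply: IB => //; exact: I0 Ix. Qed.

Let ID x y : I x -> I y -> I (x + y).
Proof. by move=> Ix Iy; rewrite -[y]opprK; apply: IB => //; exact: IN. Qed.

Lemma absorbedB x y : absorbed x -> absorbed y -> absorbed (x - y).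
Proof.
move=> Tx Ty r.
have -> : com (x - y) r = com x r - com y r.
  rewrite mulrBl mulrBr !opprB [r * y - r * x]addrC addrACA.
  by rewrite [- (y * r) + _]addrC.
exact: IB.
Qed.

(** Closure under products comes from [xy, r] = [x, yr] + [y, rx]. *)
Lemma absorbedM x y : absorbed x -> absorbed y -> absorbed (x * y).
Proof.
move=> Tx Ty r.
have -> : com (x * y) r = com x (y * r) + com y (r * x).
  by rewrite !mulrA addrA subrK.
exact: ID.
Qed.

(* If a and b are absorbed, then so is [a, b] r = [a, b r] - b [a, r]. *)
Lemma absorbed_com a b r s :
  absorbed a -> absorbed b -> absorbed (s * com a b * r).
Proof.
move=> Ta Tb.
have Tr t : absorbed (com a b * t).
  have -> : com a b * t = com a (b * t) - b * com a t.
    by rewrite mulrBr opprB !mulrA addrA subrK mulrBl.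
  apply: absorbedB; first exact/absorbed_ideal/Ta.
  by apply: absorbedM => //; exact/absorbed_ideal/Ta.
(* The left factor is moved to the right at the price of a bracket with an absorbed element, which
   lies in I. *)
have -> : s * com a b * r = com a b * (r * s) - com (com a b * r) s.
  by rewrite opprB !mulrA [RHS]addrC subrK.
by apply: absorbedB => //; exact/absorbed_ideal/Tr.
Qed.

(** For x of square zero the double bracket [[x, t], x] collapses to 2xtx, so it is a bracket of two
    elements of I to which [absorbed_com] applies. *)
Lemma absorbed_square_zero x r s t :
  absorbed x -> I x -> x * x = 0 -> absorbed (s * (x * t * x *+ 2) * r).
Proof.
move=> Tx Ix xx.
have -> : x * t * x *+ 2 = com (com x t) x.
  by rewrite mulrBl mulrBr -[t * x * x]mulrA xx mulr0 subr0 mulrA xx mul0r sub0r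
    opprK mulrA mulr2n.
by apply: absorbed_com => //; apply: absorbed_ideal; exact: Icom.
Qed.

(** On the Peirce pieces of the idempotent p, the operator ad p has eigenvalues 1, -1 and 0. Hence
    ad p + (ad p)^2 doubles the piece of eigenvalue 1 and kills the others. *)
Lemma ideal_corner x p : I x -> p * p = p -> I (p * x * (1 - p) *+ 2).
Proof.
move=> Ix pp.
have Ipx : I (com p x) by rewrite -opprB; exact/IN/Icom.
have -> : p * x * (1 - p) *+ 2 = com p x - com (com p x) p.
  rewrite [p * x * (1 - p)]mulrBr mulr1 [(_ - _) * p]mulrBl [p * (_ - _)]mulrBr.
  rewrite -[x * p * p]mulrA [p * (p * x)]mulrA pp [p * (x * p)]mulrA.
  by rewrite [in RHS]opprB [RHS]addrCA [- (_ - x * p)]opprB [_ + (x * p -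
    _)]addrA subrK mulr2n.
by apply: IB => //; exact: Icom.
Qed.

End Herstein.

(** * From one large element of an ideal to all smaller operators *)

Section LargeIdeals.
Variables (K : fieldType) (B : choiceType) (V : lmodType K) (v : B -> V).
Hypothesis v_basis : is_basis v.
Hypothesis char2 : 2 != 0 :> K.
Local Notation x_ := (coord_form v).

Variable I : set (glM v).
Hypothesis idI : is_ideal I.

Lemma ideal_com x y : I x -> I (x * y - y * x).
Proof.
have [sI aI] := idI.
by move=> Ix; rewrite -opprB; apply: (subspaceN sI); rewrite -bracketE; exact:
  aI.
Qed.

Let IB := subspaceB (proj1 idI).

Let T := absorbed I.

Let T_supp0 (psi : glM v) : supp psi = set0 -> T psi.
Proof.
move=> psi0; apply: (absorbed_ideal ideal_com).
suff -> : psi = 0 by exact: (subspace0 (proj1 idI)).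
by apply: (glM_ext v_basis) => b; apply: suppN; rewrite psi0.
Qed.

(** The hypotheses say that the entries at (g i, i) form a diagonal block with rows g(Z) disjoint
    from the columns Z. The corner [th] isolates this block, and every psi with at most |Z| nonzero
    columns factors through it. *)
Lemma absorbed_supp_le (phi : glM v) (Z : set B) (g : B -> B) : I phi ->
  (forall i, Z i -> x_ (g i) (phi (v i)) != 0) ->
  (forall i j, Z i -> Z j -> x_ (g i) (phi (v j)) != 0 -> i = j) ->
  (forall i, Z i -> ~ Z (g i)) ->
  forall psi : glM v, (supp psi #<= Z)%card -> T psi.
Proof.
move=> Iphi gd goff gZ psi psiZ.
have [psi0|/set0P[b0 sb0]] := eqVneq (supp psi) set0.
  exact: T_supp0.
have [f [fZ fI]] := card_le_fun b0 psiZ.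
have gI i j : Z i -> Z j -> g i = g j -> i = j.
  by move=> Zi Zj e; apply: goff => //; rewrite e; exact: gd.
have [h hg] : exists h, forall a, (g @` Z) a -> Z (h a) /\ g (h a) = a.
  apply: (choice_on (r := fun a i => Z i /\ g i = a) b0) => a [i Zi <-].
  by exists i.
have hK i : Z i -> h (g i) = i.
  by move=> Zi; have [|Zh e] := hg (g i); [exists i|exact: gI].
pose c i := x_ (g i) (phi (v i)).
have [p pE] : exists p : glM v, forall a,
    p (v a) = if `[< (g @` Z) a >] then v a else 0.
  apply: (glM_of_cols v_basis) => a.
  apply: sub_finite_set (finite_set1 a) => b /=.
  case: asboolP => [_|_]; last by rewrite linear0 eqxx.
  by rewrite coord_form_basis //; have [//|] := eqVneq b a; rewrite eqxx.
have pp : p * p = p.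
  apply: (glM_ext v_basis) => b; rewrite glM_mulE pE.
  by case: asboolP => [Zb|_]; [rewrite pE asboolT|rewrite linear0].
have xp a w : x_ a (p w) = if `[< (g @` Z) a >] then x_ a w else 0.
  have lp : linear (fun w => x_ a (p w) : K^o) by move=> k u u';
    rewrite !linearP.
  have lq : linear (fun w => (if `[< (g @` Z) a >] then x_ a w else 0) : K^o).
    move=> k u u'; case: ifP => _; first by rewrite linearP.
    by rewrite scaler0 addr0.
  have := lin_eq v_basis lp lq; move/(_ _)/funeqP => -> // b.
  rewrite pE; case: asboolP => [Zb|nZb].
    rewrite coord_form_basis //; case: asboolP => // nZa.
    by have [ba|//] := eqVneq b a; rewrite ba in Zb.
  rewrite linear0 coord_form_basis //; case: asboolP => // Za.
  by have [ba|//] := eqVneq b a; rewrite -ba in Za.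
(* As g(Z) misses Z, the factor 1 - p fixes v_i for i in Z; and (1 - p) p = 0 makes th of square
   zero. *)
pose th := p * phi * (1 - p).
have Ith : I th.
  have := ideal_corner IB ideal_com Iphi pp.
  move=> /(subspaceZ (proj1 idI) 2^-1).
  by rewrite -scaler_nat scalerA mulVf // scale1r.
have thth : th * th = 0.
  by rewrite /th mulrA -[_ * (1 - p) * (p * phi)]mulrA [(1 - p) * _]mulrA
    mulrBl mul1r pp subrr mul0r mulr0 mul0r.
have thE i : Z i -> th (v i) = c i *: v (g i).
  move=> Zi; have Zgi : (g @` Z) (g i) by exists i.
  have -> : th (v i) = p (phi (v i)).
    rewrite !glM_mulE glM_subE pE; case: asboolP => [[j Zj ji]|_]; last
      by rewrite subr0.
    by exfalso; apply: (gZ _ Zj); rewrite ji.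
  apply: (coord_ext v_basis) => a; rewrite xp linearZ /= coord_form_basis //.
  case: asboolP => [[j Zj <-]|nZa]; last first.
    by have [ga|] := eqVneq (g i) a; rewrite ?scaler0 //; rewrite ga in Zgi.
  have [/gI -> //|gij] := eqVneq (g i) (g j); first exact: esym (mulr1 _).
  rewrite scaler0; apply/eqP; apply: contrapT => /negP.
  by move=> /(goff _ _ Zj Zi) ji; rewrite ji eqxx in gij.
clearbody th.
(* tau sends v_(g i) back to v_i, so th tau th maps v_i to c_i^2 v_(g i). *)
have [tau tauE] : exists tau : glM v, forall a,
    tau (v a) = if `[< (g @` Z) a >] then v (h a) else 0.
  apply: (glM_of_cols v_basis) => a.
  apply: sub_finite_set (finite_set1 (g a)) => b /=.
  case: asboolP => [/hg[_ gh]|_]; last by rewrite linear0 eqxx.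
  by rewrite coord_form_basis //; have [<-|] := eqVneq (h b) a; rewrite ?eqxx.
(* beta moves the columns of psi into Z along the injection f. *)
have [beta betaE] : exists beta : glM v, forall b,
    beta (v b) = if `[< supp psi b >] then v (f b) else 0.
  apply: (glM_of_cols v_basis) => a.
  have [[x Sx fx]|nx] := pselect (exists2 x, supp psi x & f x = a).
    apply: sub_finite_set (finite_set1 x) => b /=.
    case: asboolP => [Sb|_]; last by rewrite linear0 eqxx.
    rewrite coord_form_basis //; have [fb _|] := eqVneq (f b) a; last
      by rewrite eqxx.
    by apply: fI => //; rewrite fx.
  apply: sub_finite_set (finite_set0 B) => b /=.
  case: asboolP => [Sb|_]; last by rewrite linear0 eqxx.
  rewrite coord_form_basis //; have [fb _|] := eqVneq (f b) a; last
    by rewrite eqxx.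
  by apply: nx; exists b.
have [q qP] : exists q, forall a, ((g \o f) @` supp psi) a ->
    supp psi (q a) /\ g (f (q a)) = a.
  apply: (choice_on (r := fun a x => supp psi x /\ g (f x) = a) b0).
  by move=> a [x Sx <-]; exists x.
have qK x : supp psi x -> q (g (f x)) = x.
  move=> Sx; have [|Sq e] := qP (g (f x)); first by exists x.
  by apply: fI => //; apply: gI => //; exact: fZ.
(* alpha replaces v_(g (f b)) by psi(v_b) and divides by 2 c^2, the factor that 2 th tau th
   introduces. Its rows are rows of psi reindexed, hence finite. *)
have [alpha alphaE] : exists alpha : glM v, forall a, alpha (v a) =
    if `[< ((g \o f) @` supp psi) a >]
    then (c (f (q a)) * c (f (q a)) *+ 2)^-1 *: psi (v (q a)) else 0.
  apply: (glM_of_cols v_basis) => a.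
  apply: sub_finite_set (finite_image (g \o f) (finite_row v_basis psi a)) =>
    b /=.
  case: asboolP => [/qP[Sq <-]|_]; last by rewrite linear0 eqxx.
  rewrite linearZ qK //= => xn0; exists (q b) => //.
  by apply: contra_neq xn0 => ->; rewrite scaler0.
have -> : psi = alpha * (th * tau * th *+ 2) * beta.
  apply: (glM_ext v_basis) => b; rewrite !glM_mulE betaE.
  case: asboolP => [Sb|nSb]; last first.
    by rewrite !linear0 suppN.
  have Zfb := fZ _ Sb.
  have -> : (th * tau * th *+ 2) (v (f b)) =
      (c (f b) * c (f b) *+ 2) *: v (g (f b)).
    rewrite mulr2n glM_addE !glM_mulE thE // !linearZ /= tauE asboolT; last
      by exists (f b).
    by rewrite hK // thE // scalerA -scalerDl -mulr2n.
  rewrite linearZ /= alphaE asboolT; last by exists b.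
  rewrite qK // scalerA divff ?scale1r // -mulr_natl mulf_neq0 //.
  by rewrite mulf_neq0 // gd.
by apply: (absorbed_square_zero IB ideal_com) => //; exact:
  (absorbed_ideal ideal_com).
Qed.

Definition offdiag (phi : glM v) : set B :=
  [set b | exists2 a, a != b & x_ a (phi (v b)) != 0].

(** Let g pick an off-diagonal entry in each column of a sparse Z. If g i met another column j of Z,
    or lay in Z itself, the balls around two distinct points of Z would share g i. *)
Lemma absorbed_offdiag (phi : glM v) : I phi ->
  exists Z : set B, [/\ offdiag phi !=set0 -> Z !=set0,
    infinite_set (offdiag phi) -> (offdiag phi #<= Z)%card &
    forall psi : glM v, (supp psi #<= Z)%card -> T psi].
Proof.
move=> Iphi; have [Z [ZO Z0 Zinf Zsp]] :=
  sparse_subset v_basis phi (offdiag phi).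
exists Z; split=> //.
have [->|/set0P[b0 _]] := eqVneq Z set0.
  by move=> psi; rewrite card_le0 => /eqP; exact: T_supp0.
have [g gP] : exists g, forall b, Z b -> g b != b /\ x_ (g b) (phi (v b)) != 0.
  apply: (choice_on (r := fun b a => a != b /\ x_ a (phi (v b)) != 0) b0).
  by move=> b /ZO[a ab an0]; exists a.
apply: (@absorbed_supp_le phi Z g) => //.
- by move=> i /gP[].
- move=> i j Zi Zj gij; apply: (Zsp _ _ (g i)) => //; last by constructor 3.
  by constructor 3; case: (gP _ Zi).
- move=> i Zi Zgi; have [/eqP gi gii] := gP _ Zi; apply: gi.
  by apply: (Zsp _ _ (g i)) => //; [constructor 1 | constructor 3].
Qed.

(* A diagonal operator that is not scalar is made off-diagonal by a bracket
   with an involution that exchanges points with distinct eigenvalues. *)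
Lemma absorbed_large (big : set B -> Prop) (phi : glM v) :
  (forall A C, big A -> (A !=set0 -> C !=set0) ->
     (infinite_set A -> (A #<= C)%card) -> big C) ->
  (forall A C, big (A `|` C) -> big A \/ big C) ->
  I phi -> (forall c, big (supp (phi - c *: glM_id v))) ->
  exists2 Z, big Z & forall psi : glM v, (supp psi #<= Z)%card -> T psi.
Proof.
(* [big] is abstract because two notions of size are used: being nonempty, for sl, and having at
   least aleph_s elements, for the chain. *)
move=> bigS bigU Iphi bigphi.
have big_sub A C : A `<=` C -> big A -> big C.
  move=> AC bA; apply: bigS bA _ _ => [[x /AC Cx]|_]; first by exists x.
  exact: subset_card_le.
have big_off psi : I psi -> big (offdiag psi) ->
    exists2 Z, big Z & forall psi : glM v, (supp psi #<= Z)%card -> T psi.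
  move=> Ipsi bpsi; have [Z [Z0 Zinf ZT]] := absorbed_offdiag Ipsi.
  by exists Z => //; exact: bigS bpsi _ _.
have [|noff] := pselect (big (offdiag phi)); first exact: big_off.
pose d b := x_ b (phi (v b)).
have phiE b : ~ offdiag phi b -> phi (v b) = d b *: v b.
  move=> nb; apply: (coord_ext v_basis) => a.
  rewrite linearZ /= coord_form_basis //.
  have [<-|ba] := eqVneq b a; first exact: esym (mulr1 _).
  rewrite scaler0; apply/eqP; apply: contrapT => /negP xa; apply: nb.
  by exists a => //; rewrite eq_sym.
(* Pairs of diagonal columns with distinct eigenvalues; a maximal disjoint family E of them is a
   matching, with W the set of matched points. *)
pose D := [set q : B * B | [/\ ~ offdiag phi q.1,
  ~ offdiag phi q.2 & d q.1 != d q.2]].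
have [E [ED tE maxE]] :=
  ex_maximal_disjoint_subcollection (fun q : B * B => [set q.1; q.2]) D.
pose partner a b := E (a, b) \/ E (b, a).
have partnerD a b : partner a b ->
    [/\ ~ offdiag phi a, ~ offdiag phi b & d a != d b].
  by case=> /ED[] //= ? ? dab; split=> //; rewrite eq_sym.
have partnerC a b : partner a b -> partner b a by case; [right|left].
have partner_inj a b b' : partner a b -> partner a b' -> b = b'.
  move=> ab ab'; have := partnerD _ _ ab; have := partnerD _ _ ab'.
  move=> [_ _ dab'] [_ _ dab].
  have ndiag c : d c != d c -> False by rewrite eqxx.
  case: ab ab' => [Eab|Eba] [Eab'|Eb'a].
  - have [] // : (a, b) = (a, b').
    by apply: tE => //; exists a; split; left.
  - have [ab' ba] : (a, b) = (b', a).
      by apply: tE => //; exists a; split; [left|right].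
    by rewrite ba eqxx in dab.
  - have [ba ab'] : (b, a) = (a, b').
      by apply: tE => //; exists a; split; [right|left].
    by rewrite ba eqxx in dab.
  - have [] // : (b, a) = (b', a).
    by apply: tE => //; exists a; split; right.
pose W := [set b | exists a, partner b a].
(* By maximality two unmatched points have equal eigenvalues, so a single c serves all of them. *)
have [c cP] : exists c, forall b, ~ offdiag phi b -> ~ W b -> d b = c.
  have [[b0 [nb0 nWb0]]|nb0] := pselect (exists b, ~ offdiag phi b /\ ~ W b).
    exists (d b0) => b nb nWb; apply: contrapT => /eqP dbb0.
    have nE : ~ E (b, b0) by move=> Ebb; apply: nWb; exists b0; left.
    apply: (maxE (E `|` [set (b, b0)])).
    - split=> [q|sub]; first by left.
      by apply: nE; apply: sub; right.
    - by move=> q [/ED //|->].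
    - have far q s : E q -> [set q.1; q.2] s -> [set b; b0] s -> False.
        case: q => q1 q2 Eq [] /= -> [] sb.
        + by apply: nWb; exists q2; left; rewrite -sb.
        + by apply: nWb0; exists q2; left; rewrite -sb.
        + by apply: nWb; exists q1; right; rewrite -sb.
        + by apply: nWb0; exists q1; right; rewrite -sb.
      move=> p q [Ep|->] [Eq|->] // [s [Fp Fq]].
      + by apply: tE => //; exists s.
      + by case: (far _ _ Ep Fp Fq).
      + by case: (far _ _ Eq Fq Fp).
  exists 0 => b nb nWb; exfalso; apply: nb0; by exists b.
(* phi - c id vanishes outside [offdiag phi] and W, and the former is not big. *)
have bigW : big W.
  have [] // : big (offdiag phi) \/ big W.
  apply: bigU; apply: big_sub (bigphi c) => b.
  apply: contraPP => /not_orP[nb nWb]; apply/negP; rewrite negbK.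
  by rewrite glM_subE glM_scaleE phiE // (cP b) //= subrr.
have [[b0 _]|W0] := pselect (W !=set0); last first.
  apply: (big_off _ Iphi); apply: bigS bigW _ _ => [//|Winf].
  by case: W0; exact: infinite_setN0.
have [f fP] : exists f, forall b, W b -> partner b (f b).
  exact: (choice_on (r := partner) b0).
have fK b : W b -> f (f b) = b.
  move=> Wb; have bf := fP _ Wb; apply: (partner_inj (f b)); last exact:
    partnerC.
  by apply: fP; exists b; exact: partnerC.
have [psi psiE] : exists psi : glM v, forall b,
    psi (v b) = if `[< W b >] then v (f b) else 0.
  apply: (glM_of_cols v_basis) => a.
  apply: sub_finite_set (finite_set1 (f a)) => b /=.
  case: asboolP => [Wb|_]; last by rewrite linear0 eqxx.
  rewrite coord_form_basis //; have [<- _|] := eqVneq (f b) a; last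
    by rewrite eqxx.
  by rewrite fK.
(* For b in W the bracket has at (f b, b) the difference of the two eigenvalues, so all of W is
   off-diagonal for it. *)
apply: (big_off _ (ideal_com psi Iphi)); apply: big_sub bigW => b Wb.
have [nb nfb db] := partnerD _ _ (fP _ Wb).
exists (f b); first by apply: contra_neq db => ->.
rewrite glM_subE !glM_mulE psiE asboolT // !phiE // linearZ /= psiE asboolT //.
rewrite -scalerBl linearZ /= coord_form_basis // eqxx.
by rewrite scaler_eq0 negb_or oner_eq0 subr_eq0 eq_sym db.
Qed.

(** A variant of [lin_eq] for maps that agree only on the basis vectors occurring in w. *)
Lemma lin_eq_on (W : lmodType K) (f g : V -> W) w : linear f -> linear g ->
  (forall a, x_ a w != 0 -> f (v a) = g (v a)) -> f w = g w.
Proof.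
move=> lf lg fg; have /finite_fsetP[A /seteqP[wA Aw]] := finite_coord v_basis w.
rewrite (coord_sum v_basis (A := A) (w := w)) // !linear_comb_sum //.
by apply: eq_fbigr => a /Aw xa _; rewrite fg.
Qed.

(* The swindle: with disjoint copies X_n of a set X of rows and columns of chi,
   the shift C : X_(n+1) -> X_n and D : X_n -> X_(n+1) acting as chi, [C, D] is
   the copy of chi on X_0; conjugation brings it back on X. *)
Lemma ideal_supp_le (Z : set B) : infinite_set Z ->
  (forall psi : glM v, (supp psi #<= Z)%card -> T psi) ->
  forall chi : glM v, (supp chi #<= Z)%card -> I chi.
Proof.
move=> Zinf ZT chi chiZ.
have [b0 _] := infinite_setN0 Zinf.
pose X := supp chi `|` \bigcup_(b in supp chi) [set a | x_ a (chi (v b)) != 0].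
have XZ : (X #<= Z)%card.
  apply: setU_card_le => //; apply: bigcup_card_le => // b _.
  exact/finite_set_countable/finite_col.
have [f [fZ fI]] := card_le_fun b0 XZ.
have [k [kZ kI]] := card_le_fun b0 (infinite_setX_nat Zinf).
(* j x n is the point of the copy X_n over x. Q is the union of the copies, and u reads off the
   point x and the level n. *)
pose j x n := k (f x, n).
have jZ x n : X x -> Z (j x n) by move=> Xx; apply: kZ; split=> //; exact: fZ.
have jI x n x' n' : X x -> X x' -> j x n = j x' n' -> x = x' /\ n = n'.
  move=> Xx Xx' fxx.
  have Xn y m : X y -> (Z `*` [set: nat]) (f y, m) by move=> Xy; split=> //;
    exact: fZ.
  by have [/(fI _ _ Xx Xx')] := kI _ _ (Xn _ _ Xx) (Xn _ _ Xx') fxx.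
have chiX b a : x_ a (chi (v b)) != 0 -> X a.
  move=> xa; right; exists b => //; apply: contra_neq xa => ->.
  by rewrite linear0.
have chi0 b : ~ X b -> chi (v b) = 0.
  by move=> nXb; apply: suppN => sb; apply: nXb; left.
clearbody X.
pose Q a := exists x n, X x /\ a = j x n.
have [u uP] : exists u : B -> B * nat, forall a, Q a ->
    X (u a).1 /\ a = j (u a).1 (u a).2.
  apply: (choice_on (r := fun a p => X p.1 /\ a = j p.1 p.2) (b0, 0%N)).
  by move=> a [x [n ?]]; exists (x, n).
have Qj x n : X x -> Q (j x n) by move=> Xx; exists x, n.
have uK x n : X x -> u (j x n) = (x, n).
  move=> Xx; have [Xu /esym e] := uP _ (Qj x n Xx).
  by rewrite [u _]surjective_pairing; have [-> ->] := jI _ _ _ _ Xu Xx e.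
have QZ : Q `<=` Z by move=> a [x [n [Xx ->]]]; exact: jZ.
clearbody j; clear kI kZ fI fZ.
have T_Q (psi : glM v) : (forall a, ~ Q a -> psi (v a) = 0) -> T psi.
  move=> psiQ; apply: ZT; apply: subset_card_le => a; apply: contraPP => nZa.
  by apply/negP; rewrite negbK psiQ // => /QZ.
(* J n carries X onto its copy X_n and kills the other basis vectors. *)
have [J JE] : exists J : nat -> glM v, forall n x,
    J n (v x) = if `[< X x >] then v (j x n) else 0.
  suff /choice[J JP] : forall n, exists Jn : glM v, forall x,
    Jn (v x) = if `[< X x >] then v (j x n) else 0 by exists J.
  move=> n; apply: (glM_of_cols v_basis) => a.
  apply: sub_finite_set (finite_set1 (u a).1) => x /=.
  case: asboolP => [Xx|_]; last by rewrite linear0 eqxx.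
  rewrite coord_form_basis //; have [<- _|] := eqVneq (j x n) a.
    by rewrite uK.
  by rewrite eqxx.
have xJ n c w : x_ c (J n w) =
    if `[< Q c /\ (u c).2 = n >] then x_ (u c).1 w else 0.
  pose F w : K^o := x_ c (J n w).
  pose G w : K^o := if `[< Q c /\ (u c).2 = n >] then x_ (u c).1 w else 0.
  have lF : linear F by move=> a w1 w2; rewrite /F !linearP.
  have lG : linear G.
    move=> a w1 w2; rewrite /G; case: ifP => _; first by rewrite linearP.
    by rewrite scaler0 addr0.
  rewrite -[LHS]/(F w) -[RHS]/(G w); congr (_ w); apply: (lin_eq v_basis) =>
    // x.
  rewrite /F /G JE coord_form_basis //; case: asboolP => [Xx|nXx].
    rewrite coord_form_basis //; have [jc|jc] := eqVneq (j x n) c.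
      by rewrite -jc uK //= eqxx asboolT //; split=> //; exact: Qj.
    case: asboolP => // -[Qc un]; have [_ ce] := uP _ Qc.
    by have [xu|//] := eqVneq x (u c).1; rewrite xu -un -ce eqxx in jc.
  rewrite linear0; case: asboolP => // -[/uP[Xu _] _].
  by have [xu|//] := eqVneq x (u c).1; rewrite xu in nXx.
have [C CE] : exists C : glM v, forall a, C (v a) =
    if `[< Q a /\ (u a).2 <> 0%N >] then v (j (u a).1 (u a).2.-1) else 0.
  apply: (glM_of_cols v_basis) => a.
  apply: sub_finite_set (finite_set1 (j (u a).1 (u a).2.+1)) => b /=.
  case: asboolP => [[Qb un0]|_]; last by rewrite linear0 eqxx.
  rewrite coord_form_basis //; have [<- _|] := eqVneq (j _ _) a; last
    by rewrite eqxx.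
  have [Xu be] := uP _ Qb; rewrite uK //= prednK; first exact: be.
  by rewrite lt0n; exact/eqP.
(* D applies chi while moving up one level; its rows are finite because those of chi are. *)
have [D DE] : exists D : glM v, forall a, D (v a) =
    if `[< Q a >] then J (u a).2.+1 (chi (v (u a).1)) else 0.
  apply: (glM_of_cols v_basis) => a.
  apply: sub_finite_set (finite_image (fun x => j x (u a).2.-1)
    (finite_row v_basis chi (u a).1)) => b /=.
  case: asboolP => [Qb|_]; last by rewrite linear0 eqxx.
  rewrite xJ; case: asboolP => [[Qa ua] xn0|_]; last by rewrite eqxx.
  by exists (u b).1 => //; rewrite ua /=; have [_ <-] := uP _ Qb.
have [L LE] : exists L : glM v, forall a, L (v a) =
    if `[< Q a /\ (u a).2 = 0%N >] then v (u a).1 else 0.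
  apply: (glM_of_cols v_basis) => a.
  apply: sub_finite_set (finite_set1 (j a 0%N)) => b /=.
  case: asboolP => [[Qb u0]|_]; last by rewrite linear0 eqxx.
  rewrite coord_form_basis //; have [<- _|] := eqVneq (u b).1 a; last
    by rewrite eqxx.
  by have [_ {1}->] := uP _ Qb; rewrite u0.
have CJ n : C * J n.+1 = J n.
  apply: (glM_ext v_basis) => x; rewrite glM_mulE !JE.
  case: asboolP => [Xx|_]; last by rewrite linear0.
  by rewrite CE uK // asboolT //; split=> //; exact: Qj.
(* On X_n with n > 0 both products act as chi within the level and cancel. On X_0, which C kills,
   only C D remains. *)
pose chi' := C * D - D * C.
have chi'E a : chi' (v a) =
    if `[< Q a /\ (u a).2 = 0%N >] then J 0%N (chi (v (u a).1)) else 0.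
  rewrite glM_subE !glM_mulE CE DE; case: (asboolP (Q a)) => [Qa|nQa]; last
    first.
    by rewrite !asboolF ?linear0 ?subr0 ?addr0 //; case.
  rewrite -glM_mulE CJ; have [Xu ae] := uP _ Qa.
  have [u0|un0] := pselect ((u a).2 = 0%N).
    by rewrite asboolF ?asboolT ?linear0 ?subr0 ?u0 ?addr0 //; case.
  rewrite asboolT // asboolF; last by case.
  rewrite DE asboolT; last exact: Qj.
  rewrite uK // prednK ?subrr // lt0n; exact/eqP.
have TC : T C by apply: T_Q => a nQa; rewrite CE asboolF //; case.
have Ichi' : I chi' by exact: TC.
(* L brings X_0 back to X, so L chi' J_0 = chi and J_0 L chi' = chi'. Both C and L chi' vanish off
   Q, which is contained in Z, hence are absorbed. *)
have -> : chi = chi' + (L * chi' * J 0%N - J 0%N * (L * chi')).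
  have -> : J 0%N * (L * chi') = chi'.
    apply: (glM_ext v_basis) => a; rewrite !glM_mulE chi'E.
    case: asboolP => _; last by rewrite !linear0.
    apply: (@lin_eq_on _ (fun w => J 0%N (L (J 0%N w))) (J 0%N)) =>
      [c w w'||x _].
    - by rewrite !linearP.
    - exact: glM_linear.
    - rewrite !JE; case: asboolP => [Xx|_]; last by rewrite !linear0.
      by rewrite LE uK //= asboolT ?JE ?asboolT //; split=> //; exact: Qj.
  rewrite addrC subrK; apply: (glM_ext v_basis) => x; rewrite !glM_mulE JE.
  case: asboolP => [Xx|nXx]; last by rewrite !linear0 chi0.
  rewrite chi'E asboolT; last by rewrite uK //; split=> //; exact: Qj.
  rewrite uK //=.
  apply: (@lin_eq_on _ id (fun w => L (J 0%N w))) => // [c w w'|a xa].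
    by rewrite !linearP.
  have Xa := chiX _ _ xa.
  by rewrite JE asboolT // LE uK //= asboolT //; split=> //; exact: Qj.
have TL : T (L * chi').
  apply: T_Q => a nQa; rewrite glM_mulE chi'E asboolF ?linear0 //; by case.
exact: (subspaceD (proj1 idI)) Ichi' (TL _).
Qed.

End LargeIdeals.

(** * Finite rank operators *)

Section Trace.
Variables (K : fieldType) (B : choiceType) (V : lmodType K) (v : B -> V).
Hypothesis v_basis : is_basis v.
Local Notation x_ := (coord_form v).
Implicit Types (chi psi : glM v) (F : {fset B}).

Lemma lin_fset_sum (W : lmodType K) (f : V -> W) F w : linear f ->
  (forall b, f (v b) != 0 -> b \in F) ->
  f w = \sum_(b <- F) x_ b w *: f (v b).
Proof.
move=> lf fF; have /finite_fsetP[A /seteqP[wA _]] := finite_coord v_basis w.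
rewrite {1}(coord_sum v_basis (A := (A `|` F)%fset) (w := w)); last first.
  by move=> b /wA /= bA; rewrite inE bA.
rewrite linear_comb_sum //; apply/esym/big_fset_incl; first exact: fsubsetUr.
move=> b _ bF; have [->|/fF bF'] := eqVneq (f (v b)) 0; first exact: scaler0.
by rewrite bF' in bF.
Qed.

(** Stated through the matrix, it makes the value of the evaluation pairing independent of the
    presentation as a tensor; see [trace_tensor]. *)
Definition trace chi : K := \sum_(b <- fset_set (supp chi)) x_ b (chi (v b)).

Let notin_supp chi b : finite_set (supp chi) ->
  b \notin fset_set (supp chi) -> chi (v b) = 0.
Proof.
by move=> cfin; rewrite in_fset_set // notin_setE => nb; exact: suppN nb.
Qed.

Lemma trace_fset chi F : (forall b, supp chi b -> b \in F) ->
  trace chi = \sum_(b <- F) x_ b (chi (v b)).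
Proof.
move=> sF; have sfin : finite_set (supp chi) by apply: (finite_subfset F).
apply: big_fset_incl => [|b].
  by apply/fsubsetP => b; rewrite in_fset_set // inE => /sF.
by move=> _ /notin_supp ->; rewrite // linear0.
Qed.

Lemma trace_tensor chi s : {in s, forall p, restricted_dual v p.2} ->
  chi = tensor_op s :> (V -> V) ->
  finite_set (supp chi) /\ trace chi = tensor_ev s.
Proof.
move=> sr chiE.
have /finite_fsetP[F /seteqP[sF _]] :
    finite_set (\bigcup_(p in [set` s]) [set b | p.2 (v b) != 0]).
  apply: bigcup_finite; first exact: finite_seq.
  by move=> p /sr /(restricted_dualP v_basis)[].
have pF p b : p \in s -> p.2 (v b) != 0 -> b \in F.
  by move=> ps pb; apply: sF; exists p.
have chiF b : supp chi b -> b \in F.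
  move=> sb; apply: contraT => bF; exfalso; move/negP: sb; apply.
  apply/eqP; rewrite chiE /tensor_op big1_seq // => p /andP[_ ps].
  have [->|/(pF _ _ ps) bF'] := eqVneq (p.2 (v b)) 0; first exact: scale0r.
  by rewrite bF' in bF.
split; first exact: finite_subfset chiF.
rewrite (trace_fset chiF) chiE /tensor_op /tensor_ev.
rewrite (eq_bigr (fun b => \sum_(p <- s) p.2 (v b) * x_ b p.1)); last first.
  by move=> b _; rewrite linear_comb_sum //; exact: coord_form_linear.
rewrite exchange_big /=; apply: eq_big_seq => p ps.
rewrite (@lin_fset_sum _ p.2 F p.1) //.
- by apply: eq_bigr => b _; rewrite /= [LHS]mulrC.
- exact: restricted_dual_linear (sr _ ps).
- by move=> b; exact: pF.
Qed.

Lemma tensor_finite chi : finite_set (supp chi) ->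
  exists s, [/\ {in s, forall p, restricted_dual v p.2},
    chi = tensor_op s :> (V -> V) & tensor_ev s = trace chi].
Proof.
move=> sfin; exists [seq (chi (v b), x_ b) | b <- fset_set (supp chi)]; split.
- by move=> _ /mapP[b _ ->]; apply: sub_gen_smallest; exists b.
- apply: funext => w; rewrite /tensor_op big_map /=.
  apply: (lin_fset_sum w (glM_linear chi)) => b sb.
  by rewrite in_fset_set // inE.
- by rewrite /tensor_ev big_map.
Qed.

Lemma gl_finP chi : gl_fin v chi <-> finite_set (supp chi).
Proof.
split=> [[s [sr]]|/tensor_finite[s [sr chiE _]]]; last by exists s.
by case/(trace_tensor sr).
Qed.

Lemma sl_finP chi : sl_fin v chi <-> finite_set (supp chi) /\ trace chi = 0.
Proof.
split=> [[s [sr /(trace_tensor sr)[sfin tr] ev0]]|[/tensor_finite[s []]]].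
  by rewrite tr.
by move=> sr chiE tr tr0; exists s; split=> //; rewrite tr.
Qed.

Lemma supp_lin (a : K) chi psi : supp (a *:
  chi + psi) `<=` supp chi `|` supp psi.
Proof.
move=> b; apply: contraPP => /not_orP[nc np]; have c0 := suppN nc.
have p0 := suppN np; by apply/negP;
  rewrite negbK glM_addE glM_scaleE c0 p0 scaler0 addr0.
Qed.

Lemma trace_linear a chi psi : finite_set (supp chi) -> finite_set (supp psi) ->
  trace (a *: chi + psi) = a * trace chi + trace psi.
Proof.
move=> cfin pfin.
have /finite_fsetP[F /seteqP[sF _]] : finite_set (supp chi `|` supp psi).
  by rewrite finite_setU.
rewrite !(@trace_fset _ F).
- rewrite mulr_sumr -big_split; apply: eq_bigr => b _.
  by rewrite glM_addE glM_scaleE linearP.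
- by move=> b sb; apply: sF; right.
- by move=> b sb; apply: sF; left.
- by move=> b /supp_lin /sF.
Qed.

Lemma glM_unitE a b w : glM_unit v a b w = x_ b w *: v a.
Proof. by rewrite /= /tensor_op big_seq1. Qed.

Lemma glM_unit_basis a b c : glM_unit v a b (v c) = if c == b then v a else 0.
Proof.
rewrite glM_unitE coord_form_basis //.
by case: eqP => _; rewrite ?scale1r ?scale0r.
Qed.

Lemma trace_unit b : finite_set (supp (glM_unit v b b)) /\
  trace (glM_unit v b b) = 1.
Proof.
have [|//|fin ->] := @trace_tensor (glM_unit v b b) [:: (v b, x_ b)].
  by move=> p; rewrite inE => /eqP ->; apply: sub_gen_smallest; exists b.
by split=> //; rewrite /tensor_ev big_seq1 /= coord_form_basis // eqxx.
Qed.

(** A bracket turns w (x) y into psi w (x) y - w (x) psi^* y, and both terms evaluate to y(psi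
    w). *)
Lemma sl_fin_com chi psi : gl_fin v chi -> sl_fin v (psi * chi - chi * psi).
Proof.
move=> [s [sr chiE]].
exists ([seq (psi p.1, p.2) | p <- s] ++ [seq (- p.1, p.2 \o psi) | p <- s]).
split.
- move=> p; rewrite mem_cat => /orP[] /mapP[q qs ->] /=; first exact: sr.
  by have /mackeyP[_] := glM_funP psi; apply; exact: sr.
- apply: funext => w; rewrite glM_subE !glM_mulE chiE /tensor_op big_cat
  !big_map.
  rewrite linear_comb_sum; last exact: glM_linear.
  congr (_ + _); rewrite -sumrN; apply: eq_bigr => p _.
  by rewrite /= scalerN.
- rewrite /tensor_ev big_cat !big_map /= -big_split big1_seq //= => p ps.
  have lp := restricted_dual_linear (sr _ ps).
  have lN u : p.2 (- u) = - p.2 u.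
    by have := lp (-1) u 0; rewrite !scaleN1r (linear_at0 lp) !addr0.
  by rewrite raddfN lN subrr.
Qed.

(** The finite substitute for the swindle. Up to its diagonal entry, transferred to b0, column b of
    chi is the bracket of chi e_(b,b0) with e_(b0,b); the first factor has at most one nonzero
    column, so it is absorbed as soon as Z has a point. *)
Lemma ideal_trace (I : set (glM v)) (Z : set B) : is_ideal I -> Z !=set0 ->
  (forall psi, (supp psi #<= Z)%card -> absorbed I psi) ->
  forall chi b0, finite_set (supp chi) ->
    I (chi - trace chi *: glM_unit v b0 b0).
Proof.
move=> idI [z Zz] ZT chi b0 cfin; pose e := glM_unit v.
have col b : I (chi * e b b - (x_ b (chi (v b)) : K) *: e b0 b0).
  have -> : chi * e b b - (x_ b (chi (v b)) : K) *: e b0 b0 =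
      (chi * e b b0) * e b0 b - e b0 b * (chi * e b b0).
    apply: (glM_ext v_basis) => c.
    rewrite !glM_subE glM_scaleE !glM_mulE !glM_unit_basis.
    congr (_ - _); case: (c == b); case: (c == b0);
      rewrite ?linear0 ?glM_unit_basis ?eqxx ?linear0 ?scaler0 ?glM_unitE //.
  apply: ZT; apply: card_le_trans (subset_card_le (_ : [set z] `<=` Z)).
    apply: (@fun_card_le _ _ _ _ (fun=> z)) => // c c' sc sc' _.
    suff eqb0 d : supp (chi * e b b0) d -> d = b0 by rewrite (eqb0 _ sc) (eqb0 _
      sc').
    move=> sd; have : (chi * e b b0) (v d) != 0 := sd.
    rewrite glM_mulE glM_unit_basis.
    by have [//|_] := eqVneq d b0; rewrite linear0 eqxx.
  by move=> _ ->.
pose F := fset_set (supp chi).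
have -> : chi - trace chi *: e b0 b0 =
    \sum_(b <- F) (chi * e b b - (x_ b (chi (v b)) : K) *: e b0 b0).
  rewrite big_split sumrN -scaler_suml /=; congr (_ - _).
  apply: (glM_ext v_basis) => c.
  have -> : (\sum_(b <- F) chi * e b b) (v c) = \sum_(b <- F) (chi * e b b) (v
    c).
    by elim/big_ind2: _ => // f x g y fx gy; rewrite glM_addE fx gy.
  under eq_bigr do rewrite glM_mulE glM_unit_basis.
  have [cF|cF] := boolP (c \in F).
    rewrite (big_fsetD1 c) //= eqxx big1_fset ?addr0 // => b.
    by rewrite !inE eq_sym => /andP[/negPf -> _] _; rewrite linear0.
  rewrite (notin_supp cfin cF) big1_fset // => b bF _.
  by case: eqP => [cb|_]; rewrite ?linear0 // cb bF in cF *.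
apply: (subspace_sum (proj1 idI)) => b _; exact: col.
Qed.

End Trace.

(** * Socles *)

Section SocleTheory.
Variables (K : pzRingType) (L : Type) (M : lmodType K) (act : L -> M -> M).
Hypothesis act_linear : forall x, linear (act x).

Lemma submodule_sumset N P :
  submodule act N -> submodule act P -> submodule act (sumset N P).
Proof.
move=> [sN aN] [sP aP]; split; first split.
- by exists 0, 0; split; [exact: subspace0 sN|exact:
  subspace0 sP|rewrite addr0].
- move=> a _ _ [u1 [u2 [Nu Pu ->]]] [w1 [w2 [Nw Pw ->]]].
  exists (a *: u1 + w1), (a *: u2 + w2).
  by split; [exact: (proj2 sN)|exact: (proj2 sP)|rewrite scalerDr addrACA].
- move=> x _ [u1 [u2 [Nu Pu ->]]]; exists (act x u1), (act x u2).
  split; [exact: aN|exact: aP|].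
  by rewrite -{1}[u1]scale1r act_linear scale1r.
Qed.

(** The span of all simple submodules is itself semisimple, so it is the largest term of the union
    that defines the socle. *)
Lemma socleE :
  socle act = lspan (\bigcup_(P in [set P | simple_submodule act P]) P).
Proof.
set S := \bigcup_(P in _) P.
apply/seteqP; split=> [u [N [_ NE] Nu]|u Su].
  rewrite NE in Nu; apply: Nu; split; first exact: subspace_span.
  by move=> w [P [simP _] Pw]; apply: sub_gen_smallest; exists P.
exists (lspan S) => //.
have sS := subspace_span S.
split.
  split=> // x w Sw.
  (* The vectors of the span that [act x] keeps in the span form a subspace containing every simple
     submodule. *)
  suff [] : [set w | lspan S w /\ lspan S (act x w)] w by [].
  apply: Sw; split.
    split.
      split; first exact: (subspace0 sS).
      by rewrite linear_at0 //; exact: (subspace0 sS).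
    move=> a w1 w2 [S1 S1'] [S2 S2'].
    by split; rewrite ?act_linear; apply: (proj2 sS).
  move=> y [P simP Py]; have [[_ aP] _ _] := simP.
  by split; apply: sub_gen_smallest; exists P => //; exact: aP.
apply/seteqP; split; last first.
  by apply: (smallest_sub sS) => w [P [_ PS] Pw]; exact: PS.
apply: (smallest_sub (subspace_span _)) => w [P simP Pw].
apply: sub_gen_smallest; exists P => //; split=> //.
by move=> y Py; apply: sub_gen_smallest; exists P.
Qed.

End SocleTheory.

Section SocleOfQuotient.
Variables (K : pzRingType) (L : Type) (M : lmodType K) (act : L -> M -> M).
Hypothesis act_linear : forall x, linear (act x).
Variables N P : set M.
Hypotheses (subN : submodule act N) (subP : submodule act P) (NP : N `<=` P).
Hypothesis (PN : ~ P `<=` N).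
Hypothesis minP : forall Q,
  submodule act Q -> N `<=` Q -> ~ Q `<=` N -> P `<=` Q.

Let quot_proj_eq u w : quot_proj N u = quot_proj N w <-> N (u - w).
Proof.
have spanN : lspan N = N by apply: span_subspace; case: subN.
have memN y : (y \in span_pred N) = (y \in lspan N) by [].
split=> [/quot_projP|Nuw]; first by rewrite memN spanN => /set_mem.
by apply/quot_projP; rewrite memN spanN; exact: mem_set.
Qed.

Let proj0 : quot_proj N 0 = 0.
Proof. by apply: (addrI (quot_proj N 0)); rewrite -quot_projD !addr0. Qed.

Let proj_eq0 u : quot_proj N u = 0 <-> N u.
Proof. by rewrite -proj0 quot_proj_eq subr0. Qed.

Let projZ a u : quot_proj N (a *: u) = a *: quot_proj N u.
Proof. by apply: esym; exact: quot_scale_proj. Qed.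

Let quot_actE x u : quot_act act x (quot_proj N u) = quot_proj N (act x u).
Proof.
rewrite /quot_act; apply/quot_proj_eq.
have -> : act x (repr (quot_proj N u)) - act x u =
          act x (repr (quot_proj N u) - u).
  by rewrite addrC -scaleN1r -act_linear scaleN1r addrC.
by apply: (proj2 subN); apply/quot_proj_eq; rewrite quot_proj_repr.
Qed.

Let quot_act_linear x : linear (@quot_act _ _ _ act N x).
Proof.
move=> a p q; rewrite -[p]quot_proj_repr -[q]quot_proj_repr -projZ -quot_projD.
by rewrite !quot_actE act_linear quot_projD projZ.
Qed.

Let sub_preim (Q : set (quotmod N)) : submodule (@quot_act _ _ _ act N) Q ->
  submodule act (quot_proj N @^-1` Q).
Proof.
move=> [sQ aQ]; split; first split=> [|a u w Qu Qw].
- by rewrite /preimage /= proj0; exact: subspace0 sQ.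
- by rewrite /preimage /= quot_projD projZ; apply: (proj2 sQ).
- by move=> x u Qu; rewrite /preimage /= -quot_actE; exact: aQ.
Qed.

Let preim_sub (Q : set (quotmod N)) : submodule (@quot_act _ _ _ act N) Q ->
  N `<=` quot_proj N @^-1` Q.
Proof. by move=> [[Q0 _] _] u Nu; rewrite /preimage /= (proj_eq0 u).2. Qed.

Let preim_min (Q : set (quotmod N)) : submodule (@quot_act _ _ _ act N) Q ->
  Q = [set 0] \/ quot_proj N @` P `<=` Q.
Proof.
move=> sQ; have [QN|QN] := pselect (quot_proj N @^-1` Q `<=` N).
  left; apply/seteqP; split=> [q Qq|_ ->]; last exact: (subspace0 (proj1 sQ)).
  rewrite /= -[q]quot_proj_repr; apply/proj_eq0/QN.
  by rewrite /preimage /= quot_proj_repr.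
right=> _ [u Pu <-].
by apply: (minP (sub_preim sQ) (preim_sub sQ) QN).
Qed.

(** By [minP] every nonzero submodule of the quotient contains the image of P, which is therefore
    the only simple submodule and equals the socle. *)
Lemma socle_quot :
  quot_proj N @^-1` socle (@quot_act _ _ _ act N) = P.
Proof.
pose S := quot_proj N @` P.
have subS : submodule (@quot_act _ _ _ act N) S.
  have [[P0 PD] aP] := subP.
  split; first split.
  - by exists 0.
  - move=> a _ _ [u Pu <-] [w Pw <-]; rewrite -projZ -quot_projD.
    by exists (a *: u + w) => //; exact: PD.
  - by move=> x _ [u Pu <-]; exists (act x u); [exact: aP|rewrite quot_actE].
have S_neq0 : S <> [set 0].
  move=> S0; apply: PN => u Pu; apply/proj_eq0.
  suff : [set (0 : quotmod N)] (quot_proj N u) by [].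
  by rewrite -S0; exists u.
have simS : simple_submodule (@quot_act _ _ _ act N) S.
  split=> // Q sQ QS; have [|SQ] := preim_min sQ; first by left.
  by right; apply/seteqP; split.
rewrite (socleE quot_act_linear).
have -> : \bigcup_(Q in [set Q | simple_submodule (@quot_act _ _ _ act N) Q]) Q
  = S.
  apply/seteqP; split=> [q [Q [sQ Q0 minQ]]|q Sq]; last by exists S.
  have [//|SQ] := preim_min sQ; have [//|<- //] := minQ _ subS SQ.
rewrite (span_subspace (proj1 subS)).
apply/seteqP; split=> [u [w Pw /quot_proj_eq wu]|u Pu]; last by exists u.
rewrite -[u](subrK w) -opprB; apply: (subspaceD (proj1 subP)) => //.
by apply: (subspaceN (proj1 subP)); exact: NP.
Qed.

End SocleOfQuotient.

(** * The list of ideals *)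

Section Classification.
Variables (K : fieldType) (t : nat) (B : choiceType) (V : lmodType K) (v :
  B -> V).
Hypothesis v_basis : is_basis v.
Hypothesis char2 : 2 != 0 :> K.
Hypothesis card_B : has_card_aleph t [set: B].
Local Notation x_ := (coord_form v).
Implicit Types (phi psi chi : glM v) (N I : set (glM v)).

Local Notation id_ := (glM_id v).
Local Notation e_ b := (glM_unit v b b).

Lemma aleph_subset s : (s <= t)%N -> exists A : set B, has_card_aleph s A.
Proof. by move=> st; have [A _ As] := aleph_sub st card_B; exists A. Qed.

Let Binf : infinite_set [set: B] := aleph_infinite card_B.

Lemma bracket_linear phi : linear (bracket v phi).
Proof.
move=> a chi psi; rewrite !bracketE; apply: (glM_ext v_basis) => b.
rewrite !(glM_subE, glM_addE, glM_scaleE, glM_mulE) linearP scalerBr.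
by rewrite /= opprD addrACA.
Qed.

Lemma scalarsP phi : scalars v phi <-> exists c, phi = c *: id_.
Proof. by split=> [[c _ <-]|[c ->]]; exists c. Qed.

Lemma sum_scalarsP N phi : sumset (scalars v) N phi <-> exists c, N (phi - c *:
  id_).
Proof.
split=> [[_ [chi [[c _ <-] Nchi ->]]]|[c Nphi]]; first by exists c;
  rewrite addrC addKr.
by exists (c *: id_), (phi - c *: id_); split; [exists c| |rewrite addrC subrK].
Qed.

Lemma sum_scalars_sub N : N 0 -> scalars v `<=` sumset (scalars v) N.
Proof. by move=> N0 phi /scalarsP[c ->]; apply/sum_scalarsP; exists c;
  rewrite subrr. Qed.

Lemma sum_sub N : N `<=` sumset (scalars v) N.
Proof. by move=> phi Nphi; apply/sum_scalarsP; exists 0; rewrite scale0r subr0.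
  Qed.

Lemma bracket_id phi psi c : bracket v psi (phi - c *: id_) = bracket v psi phi.
Proof.
rewrite !bracketE mulrBr mulrBl; apply: (glM_ext v_basis) => b.
rewrite !(glM_subE, glM_mulE, glM_scaleE) linearZ /= opprB addrA subrK.
by [].
Qed.

Lemma scalars_ideal : is_ideal (scalars v).
Proof.
split; first split.
- by apply/scalarsP; exists 0; rewrite scale0r.
- move=> a _ _ /scalarsP[c ->] /scalarsP[d ->]; apply/scalarsP.
  by exists (a * c + d); rewrite scalerDl scalerA.
- move=> psi _ /scalarsP[c ->]; apply/scalarsP; exists 0.
  rewrite scale0r bracketE; apply: (glM_ext v_basis) => b.
  by rewrite glM_subE !glM_mulE !glM_scaleE linearZ /= subrr.
Qed.

Lemma card_lt_aleph_bigcup s (S : set B) (F : B -> set B) (A : set B) :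
  has_card_aleph s A -> (forall i, finite_set (F i)) ->
  card_lt_aleph S s -> card_lt_aleph (\bigcup_(i in S) F i) s.
Proof.
move=> As Ffin /(card_lt_alephE _ As) nAS; apply/(card_lt_alephE _ As) => AF.
have [Sfin|Sinf] := pselect (finite_set S).
  apply: (aleph_infinite As); apply: card_le_finite AF _.
  by apply: bigcup_finite => // i _.
apply: nAS; apply: card_le_trans AF _.
by apply: bigcup_card_le => // i _; exact: finite_set_countable.
Qed.

Lemma card_lt_aleph_sub s (S S' : set B) (A : set B) :
  has_card_aleph s A -> S `<=` S' -> card_lt_aleph S' s -> card_lt_aleph S s.
Proof.
move=> As SS' /(card_lt_alephE _ As) nAS; apply/(card_lt_alephE _ As) => AS.
by apply: nAS; apply: card_le_trans AS _; exact: subset_card_le.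
Qed.

(** The larger of the two sets, when infinite, absorbs the union; when it is finite, so is the
    union. *)
Lemma aleph_leU s (A S S' : set B) : has_card_aleph s A ->
  (A #<= S `|` S')%card -> (A #<= S)%card \/ (A #<= S')%card.
Proof.
move=> As; wlog SS' : S S' / (S #<= S')%card => [wl|].
  have [/wl//|/wl] := card_le_total S S'.
  by rewrite setUC => wl'; move=> /wl' [|]; [right|left].
move=> AU; right; have [fin|inf] := pselect (finite_set S'); last first.
  by apply: card_le_trans AU _; apply: setU_card_le.
exfalso; apply: (aleph_infinite As); apply: card_le_finite AU _.
by rewrite finite_setU; split=> //; exact: card_le_finite SS' _.
Qed.

(** psi phi has its support inside that of phi. The support of phi psi lies in the union of the rows
    of psi indexed by [supp phi]; these are finite, so the bound persists. *)
Lemma glM_s_ideal s : (s <= t)%N -> is_ideal (glM_s v s).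
Proof.
move=> /aleph_subset[A As]; have sP := glM_sP v_basis _ As.
split; first split.
- apply/sP; apply/(card_lt_alephE _ As).
  have -> : supp (0 : glM v) = set0 by apply/seteqP; split=> b //=;
    rewrite /supp /= eqxx.
  by rewrite card_le0 => /eqP A0; apply: (aleph_infinite As); rewrite A0.
- move=> a phi psi /sP sphi /sP spsi; apply/sP/(card_lt_alephE _ As) => AS.
  have := card_le_trans AS (subset_card_le (@supp_lin _ _ _ v a phi psi)).
  by case/(aleph_leU As); apply/(card_lt_alephE _ As).
- move=> psi phi /sP sphi; rewrite bracketE.
  have -> : psi * phi - phi * psi = (-1) *: (phi * psi) + psi * phi.
    by rewrite scaleN1r addrC.
  apply/sP/(card_lt_alephE _ As) => AS.
  have := card_le_trans AS (subset_card_le (@supp_lin _ _ _ v (-1) (phi * psi)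
    (psi * phi))).
  case/(aleph_leU As); apply/(card_lt_alephE _ As).
    apply: (@card_lt_aleph_sub _ _
      (\bigcup_(a in supp phi) [set b | x_ a (psi (v b)) != 0]) _ As).
      move=> b sb; apply: contrapT => nb; move/negP: sb; apply.
      rewrite glM_mulE (@lin_eq_on _ _ _ _ v_basis _ phi (fun=> 0)) //.
      + exact: glM_linear.
      + by move=> c u w; rewrite scaler0 addr0.
      + move=> a xa; apply: suppN => sa; apply: nb; by exists a.
    by apply: card_lt_aleph_bigcup As _ sphi => a; exact: finite_row.
  apply: card_lt_aleph_sub As _ sphi => b.
  apply: contraPP => nb; apply/negP.
  by rewrite negbK glM_mulE (suppN nb) linear0.
Qed.

Lemma glM_s0P phi : glM_s v 0 phi <-> finite_set (supp phi).
Proof.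
have [A A0] := aleph_subset (leq0n t).
by rewrite (glM_sP v_basis _ A0) card_lt_aleph0.
Qed.

Lemma glM_s0 : glM_s v 0 = gl_fin v.
Proof. by apply/seteqP; split=> phi; rewrite glM_s0P gl_finP. Qed.

Lemma sl_sub_gl : sl_fin v `<=` glM_s v 0.
Proof. by move=> phi /(sl_finP v_basis)[? _]; apply/glM_s0P. Qed.

Lemma glM_s_mono s s' : (s <= s')%N -> (s' <= t)%N -> glM_s v s `<=` glM_s v s'.
Proof.
move=> ss' s't phi; have [A' As'] := aleph_subset s't.
have [A AA' As] := aleph_sub ss' As'.
move=> /(glM_sP v_basis _ As) /(card_lt_alephE _ As) nA.
apply/(glM_sP v_basis _ As')/(card_lt_alephE _ As') => A'S; apply: nA.
by apply: card_le_trans A'S; exact: subset_card_le.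
Qed.

Lemma sl_fin_ideal : is_ideal (sl_fin v).
Proof.
split; first split.
- apply/(sl_finP v_basis); have -> : (0 : glM v) = 0 *:
  0 + 0 by rewrite scaler0 addr0.
  suff fin0 : finite_set (supp (0 : glM v)).
    by rewrite trace_linear //; split; [rewrite scaler0 addr0|
      rewrite mul0r add0r /trace big1 // => b _; exact: linear0].
  by apply: sub_finite_set (finite_set0 B) => b; rewrite /supp /= eqxx.
- move=> a phi psi /(sl_finP v_basis)[fphi tphi] /(sl_finP v_basis)[fpsi tpsi].
  apply/(sl_finP v_basis); split.
    by apply: sub_finite_set (@supp_lin _ _ _ v a phi psi) _;
      rewrite finite_setU.
  by rewrite trace_linear // tphi tpsi mulr0 addr0.
- move=> psi phi /sl_sub_gl; rewrite glM_s0 bracketE => gphi.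
  exact: sl_fin_com.
Qed.

Lemma sl_decomp b phi : finite_set (supp phi) ->
  sl_fin v (phi - trace phi *: e_ b).
Proof.
move=> fphi; have [fe te] := trace_unit v_basis b.
have -> : phi - trace phi *: e_ b = (- trace phi) *: e_ b + phi.
  by rewrite scaleNr addrC.
apply/(sl_finP v_basis); split.
  by apply: sub_finite_set (@supp_lin _ _ _ v _ _ _) _; rewrite finite_setU.
by rewrite trace_linear // te mulr1 addNr.
Qed.

Lemma unit_gl b : glM_s v 0 (e_ b).
Proof. by apply/glM_s0P; case: (trace_unit v_basis b). Qed.

Lemma supp_id_scale c : c != 0 -> supp (c *: id_) = setT.
Proof.
move=> c0; apply/seteqP; split=> // b _;
  rewrite /supp /mkset glM_scaleE scaler_eq0 negb_or c0.
apply/eqP => vb0; have := coord_form_basis v_basis b b.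
by rewrite [v b]vb0 linear0 eqxx => /esym /eqP; rewrite oner_eq0.
Qed.

Lemma scale_id_glM_s s c : (s <= t)%N -> glM_s v s (c *: id_) -> c = 0.
Proof.
move=> st; have [A As] := aleph_subset st.
move=> /(glM_sP v_basis _ As)/(card_lt_alephE _ As) nA.
apply/eqP; apply: contraT => c0; exfalso; apply: nA.
by rewrite supp_id_scale //; exact: subset_card_le.
Qed.

Lemma scalars_glM_s s : (s <= t)%N -> scalars v `&` glM_s v s = [set 0].
Proof.
move=> st; apply/seteqP; split=>
  [phi [/scalarsP[c ->] /(scale_id_glM_s st) ->]|_ ->].
  by rewrite scale0r.
split; first exact: (subspace0 (proj1 scalars_ideal)).
exact: (subspace0 (proj1 (glM_s_ideal st))).
Qed.

Lemma scalars_sl : scalars v `&` sl_fin v = [set 0].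
Proof.
apply/seteqP; split=> [phi [cphi /sl_sub_gl gphi]|_ ->].
  by rewrite -(scalars_glM_s (leq0n t)).
split; first exact: (subspace0 (proj1 scalars_ideal)).
exact: (subspace0 (proj1 sl_fin_ideal)).
Qed.

Lemma id_neq0 : id_ <> 0.
Proof.
move=> id0; have := @scale_id_glM_s 0 1 (leq0n t); rewrite id0 scaler0.
move=> /(_ (subspace0 (proj1 (glM_s_ideal (leq0n t))))) /eqP.
by rewrite oner_eq0.
Qed.

Lemma unit_notin b : ~ sumset (scalars v) (sl_fin v) (e_ b).
Proof.
move=> /sum_scalarsP[c sc].
have c0 : c = 0.
  apply: (scale_id_glM_s (leq0n t)); rewrite -[_ *: _](subKr (e_ b)).
  apply: (subspaceB (proj1 (glM_s_ideal (leq0n t)))); first exact: unit_gl.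
  exact: sl_sub_gl.
move: sc; rewrite c0 scale0r subr0 => /(sl_finP v_basis)[_].
by have [_ ->] := trace_unit v_basis b => /eqP; rewrite oner_eq0.
Qed.

(** [absorbed_large] for the size notion of being nonempty: phi is not scalar exactly when every phi
    - c id has a nonzero column. *)
Lemma ideal_nonscalar I phi : is_ideal I -> I phi -> ~ scalars v phi ->
  forall chi b, finite_set (supp chi) -> I (chi - trace chi *: e_ b).
Proof.
move=> idI Iphi nphi.
have [||//||Z Z0 ZT] := @absorbed_large _ _ _ _ v_basis char2 _ idI
    (fun S => S !=set0) phi; last 1 first.
- exact: (ideal_trace v_basis idI Z0 ZT).
- by move=> A C A0 toC _; exact: toC.
- by move=> A C [b [Ab|Cb]]; [left|right]; exists b.
- move=> c; apply: contrapT => s0; apply: nphi; apply/scalarsP; exists c.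
  apply/eqP; rewrite -subr_eq0; apply/eqP; apply: (glM_ext v_basis) => b.
  by apply: suppN => sb; apply: s0; exists b.
Qed.

Lemma ideal_sl I phi :
  is_ideal I -> I phi -> ~ scalars v phi -> sl_fin v `<=` I.
Proof.
move=> idI Iphi nphi chi /(sl_finP v_basis)[fchi tchi].
have [b0 _] := infinite_setN0 Binf.
by have := ideal_nonscalar idI Iphi nphi b0 fchi; rewrite tchi scale0r subr0.
Qed.

(** [absorbed_large] for the size notion of having at least aleph_s elements, followed by the
    swindle. *)
Lemma ideal_notin_s I phi s (A : set B) : has_card_aleph s A ->
  is_ideal I -> I phi -> ~ sumset (scalars v) (glM_s v s) phi ->
  forall chi, (supp chi #<= A)%card -> I chi.
Proof.
move=> As idI Iphi nphi chi chiA.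
have [||//||Z AZ ZT] := @absorbed_large _ _ _ _ v_basis char2 _ idI
    (fun S => (A #<= S)%card) phi; last 1 first.
- apply: (ideal_supp_le v_basis idI _ ZT); last exact: card_le_trans AZ.
  exact: card_le_infinite AZ (aleph_infinite As).
- move=> S S' AS _ SS'; apply: (card_le_trans AS); apply: SS'.
  exact: card_le_infinite AS (aleph_infinite As).
- by move=> S S'; exact: aleph_leU As.
- move=> c; apply: contrapT => nA; apply: nphi; apply/sum_scalarsP; exists c.
  by apply/(glM_sP v_basis _ As)/(card_lt_alephE _ As).
Qed.

Lemma ideal_notin_lt I s : (s < t)%N -> is_ideal I ->
  ~ I `<=` sumset (scalars v) (glM_s v s) -> glM_s v s.+1 `<=` I.
Proof.
move=> st idI /existsNP[phi /not_implyP[Iphi nphi]] chi.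
have [A' As'] := aleph_subset st; have [A AA' As] := aleph_sub (leqnSn s) As'.
move=> /(glM_sP v_basis _ As') /(card_le_alephE _ As As') chiA.
exact: (ideal_notin_s As idI Iphi nphi).
Qed.

(** The top of the chain: B itself has cardinality aleph_t, so the bound on the support holds for
    every operator. *)
Lemma ideal_notin_t I : is_ideal I ->
  ~ I `<=` sumset (scalars v) (glM_s v t) -> I = setT.
Proof.
move=> idI /existsNP[phi /not_implyP[Iphi nphi]]; apply/seteqP; split=>
  // chi _.
by apply: (ideal_notin_s card_B idI Iphi nphi); exact: subset_card_le.
Qed.


Lemma ideal_notin I s : (s <= t)%N -> is_ideal I ->
  ~ I `<=` sumset (scalars v) (glM_s v s) -> glM_s v s `<=` I.
Proof.
rewrite leq_eqVlt => /predU1P[->|st] idI nI; first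
  by rewrite (ideal_notin_t idI nI).
exact: subset_trans (glM_s_mono (leqnSn s) st) (ideal_notin_lt st idI nI).
Qed.

(* The projection onto the span of half of a set of cardinality aleph_s. *)
Lemma exists_gap s (A : set B) : has_card_aleph s A ->
  exists2 phi, (supp phi #<= A)%card & ~ sumset (scalars v) (glM_s v s) phi.
Proof.
move=> As; have Ainf := aleph_infinite As.
have [b0 _] := infinite_setN0 Ainf.
have [k [kA kI]] := card_le_fun b0 (infinite_setX_nat Ainf).
pose half n := [set k (x, n) | x in A].
have Ahalf n : (A #<= half n)%card.
  apply: (@fun_card_le _ _ _ _ (fun x => k (x, n))) => [x Ax|x y Ax Ay]; first
    by exists x.
  by move=> /(kI (x, n) (y, n) (conj Ax I) (conj Ay I))[].
have halfD : forall b, half 0%N b -> ~ half 1%N b.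
  move=> _ [x Ax <-] [y Ay /(kI (y, 1%N) (x, 0%N) (conj Ay I) (conj Ax I))].
  by [].
have [phi phiE] : exists phi : glM v, forall b,
    phi (v b) = if `[< half 0%N b >] then v b else 0.
  apply: (glM_of_cols v_basis) => a; apply: sub_finite_set (finite_set1 a) =>
    b /=.
  case: asboolP => _; last by rewrite linear0 eqxx.
  by rewrite coord_form_basis //; have [|] := eqVneq b a; rewrite ?eqxx.
have vn0 b : v b != 0.
  apply/eqP => vb; have := coord_form_basis v_basis b b.
  by rewrite vb linear0 eqxx => /esym /eqP; rewrite oner_eq0.
exists phi.
  apply: subset_card_le => b sb; have : phi (v b) != 0 := sb.
  rewrite phiE; case: asboolP => [[x Ax <-] _|_]; last by rewrite eqxx.
  exact: (kA (x, 0%N) (conj Ax I)).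
move=> /sum_scalarsP[c] /(glM_sP v_basis _ As)/(card_lt_alephE _ As); apply.
(* For c = 0 the first half survives in phi - c id; otherwise the second does, as phi vanishes
   there. *)
have [c0|c0] := eqVneq c 0.
  apply: card_le_trans (Ahalf 0%N) (subset_card_le _) => b hb.
  by rewrite /supp /mkset glM_subE glM_scaleE c0 scale0r subr0 phiE asboolT.
apply: card_le_trans (Ahalf 1%N) (subset_card_le _) => b hb.
rewrite /supp /mkset glM_subE glM_scaleE phiE asboolF; last first.
  by move=> h0; exact: halfD h0 hb.
by rewrite sub0r oppr_eq0 scaler_eq0 negb_or c0 vn0.
Qed.

Lemma sum_scalars_glM_s_neqT s : (s <= t)%N ->
  sumset (scalars v) (glM_s v s) <> setT.
Proof.
move=> st sT; have [A As] := aleph_subset st.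
by have [phi _] := exists_gap As; apply; rewrite sT.
Qed.

Lemma glM_s_lt s : (s < t)%N -> ~ glM_s v s.+1 `<=` sumset (scalars v) (glM_s v
  s).
Proof.
move=> st sub; have [A' As'] := aleph_subset st.
have [A AA' As] := aleph_sub (leqnSn s) As'.
have [phi phiA nphi] := exists_gap As; apply/nphi/sub.
apply/(glM_sP v_basis _ As').
exact/(card_le_alephE _ As As').
Qed.

Lemma bracket_sl psi phi : sumset (scalars v) (glM_s v 0) phi ->
  sl_fin v (bracket v psi phi).
Proof.
move=> /sum_scalarsP[c gphi]; rewrite -(bracket_id phi psi c) bracketE.
by apply: sl_fin_com => //; rewrite -glM_s0.
Qed.

(** Brackets with scalars plus finite rank operators fall into sl, so stability under the action is
    automatic. This is what makes room for the one-parameter family. *)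
Lemma between_sl_ideal N : subspace N -> sl_fin v `<=` N ->
  N `<=` sumset (scalars v) (glM_s v 0) -> is_ideal N.
Proof. by move=> sN slN Ngl; split=> // psi phi /Ngl /bracket_sl /slN. Qed.

Lemma shifted_slP z b phi : shifted_sl v z b phi <->
  exists a, sl_fin v (phi - a *: (z *: id_ + e_ b)).
Proof.
split=> [[_ [chi [[c _ <-] slchi ->]]]|[c sphi]].
  by exists c; rewrite addrC addKr.
exists (c *: (z *: id_ + e_ b)), (phi - c *: (z *: id_ + e_ b)).
by split; [exists c| |rewrite addrC subrK].
Qed.

Lemma shifted_sl_gl z b : shifted_sl v z b `<=` sumset (scalars v) (glM_s v 0).
Proof.
move=> phi /shifted_slP[a slphi]; apply/sum_scalarsP; exists (a * z).
have g0 := proj1 (glM_s_ideal (leq0n t)).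
have -> : phi - (a * z) *: id_ = phi - a *: (z *: id_ + e_ b) + a *: e_ b.
  by rewrite scalerDr scalerA opprD addrA subrK.
apply: (subspaceD g0); first exact: sl_sub_gl.
by apply: (subspaceZ g0); exact: unit_gl.
Qed.

Lemma sl_shifted z b : sl_fin v `<=` shifted_sl v z b.
Proof. by move=> phi slphi; apply/shifted_slP; exists 0; rewrite scale0r subr0.
  Qed.

Lemma shifted_sl_ideal z b : is_ideal (shifted_sl v z b).
Proof.
apply: between_sl_ideal; [|exact: sl_shifted|exact: shifted_sl_gl].
have sl0 := proj1 sl_fin_ideal; split.
  by apply: sl_shifted; exact: (subspace0 sl0).
move=> a phi psi /shifted_slP[c sphi] /shifted_slP[d spsi]; apply/shifted_slP.
exists (a * c + d); rewrite scalerDl -scalerA opprD addrACA -scalerBr.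
exact: (proj2 sl0).
Qed.

(** The difference of two diagonal units has trace zero. *)
Lemma shifted_sl_indep z b b' : shifted_sl v z b `<=` shifted_sl v z b'.
Proof.
move=> phi /shifted_slP[a sphi]; apply/shifted_slP; exists a.
have sl0 := proj1 sl_fin_ideal.
have [fe te] := trace_unit v_basis b.
have := sl_decomp b' fe; rewrite te scale1r => see.
have -> : phi - a *: (z *: id_ + e_ b') =
    phi - a *: (z *: id_ + e_ b) + a *: (e_ b - e_ b').
  rewrite !scalerDr scalerN !opprD !addrA subrK.
  by [].
by apply: (subspaceD sl0) => //; exact: (subspaceZ sl0).
Qed.

Lemma sl_neq0 : exists2 chi, sl_fin v chi & chi <> 0.
Proof.
have [b _] := infinite_setN0 Binf.
have [a ab] : exists a, a <> b.
  apply: contrapT => /forallNP ab; apply: Binf.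
  apply: sub_finite_set (finite_set1 b) => a _; exact: contrapT (ab a).
have [fe te] := trace_unit v_basis a.
exists (e_ a - e_ b); first by have := sl_decomp b fe; rewrite te scale1r.
move=> eab; have : (e_ a - e_ b) (v a) = 0 by rewrite eab.
rewrite glM_subE !glM_unit_basis // eqxx; case: eqP => // _; rewrite subr0 =>
  va.
have := coord_form_basis v_basis a a.
by rewrite va linear0 eqxx => /esym /eqP; rewrite oner_eq0.
Qed.

(** All listed ideals inherit properness from the largest of them, the scalars plus [glM_s v t]. *)
Lemma listed_ideal I : is_ideal I -> I `<=` sumset (scalars v) (glM_s v t) ->
  (exists2 phi, I phi & phi <> 0) ->
  [/\ is_ideal I, I <> [set 0] & I <> setT].
Proof.
move=> idI It [phi Iphi phi0]; split=> // I0; first by rewrite I0 in Iphi.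
apply: (sum_scalars_glM_s_neqT (leqnn t)); apply/seteqP; split=> // psi _.
by apply: It; rewrite I0.
Qed.

(** Modulo N the sum is spanned by the identity, so whether I contains it decides between the two
    cases. *)
Lemma scalars_or_sum I N : is_ideal I -> is_ideal N -> N `<=` I ->
  I `<=` sumset (scalars v) N -> I = N \/ I = sumset (scalars v) N.
Proof.
move=> [sI _] [sN _] NI Isum.
have [idI|nid] := pselect (I id_); [right|left]; apply/seteqP; split=> // phi.
- move=> /sum_scalarsP[c /NI Iphi]; rewrite -[phi](subrK (c *: id_)).
  by apply: (subspaceD sI) => //; exact: (subspaceZ sI).
- move=> Iphi; have /sum_scalarsP[c Nphi] := Isum _ Iphi.
  have [c0|c0] := eqVneq c 0; first by rewrite c0 scale0r subr0 in Nphi.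
  exfalso; apply: nid; rewrite -[id_](scalerK c0); apply: (subspaceZ sI).
  by rewrite -[_ *: _](subKr phi); apply: (subspaceB sI) => //; exact: NI.
Qed.

Lemma ideal_gl0 I b : is_ideal I -> sl_fin v `<=` I -> I (e_ b) -> glM_s v 0
  `<=` I.
Proof.
move=> [sI _] slI Ie chi /glM_s0P fchi.
rewrite -[chi](subrK (trace chi *: e_ b)); apply: (subspaceD sI).
  by apply: slI; exact: sl_decomp.
exact: (subspaceZ sI).
Qed.

(** A classification of the subspaces of the plane spanned modulo sl by id and e_b: zero, the two
    axes, the whole plane, and the lines off the axes, with z as their slope. *)
Lemma ideal_finite I : is_ideal I -> sl_fin v `<=` I ->
  I `<=` sumset (scalars v) (glM_s v 0) ->
  [\/ I = sl_fin v, I = sumset (scalars v) (sl_fin v),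
      exists z b, z != 0 /\ I = shifted_sl v z b |
      I = glM_s v 0 \/ I = sumset (scalars v) (glM_s v 0)].
Proof.
move=> idI slI Igl; have [sI _] := idI; have [sl0 _] := sl_fin_ideal.
have [b _] := infinite_setN0 Binf.
have [Ie|nIe] := pselect (I (e_ b)).
  constructor 4; apply: scalars_or_sum => //; first exact: glM_s_ideal.
  exact: ideal_gl0 Ie.
have IE phi : I phi -> exists c a, [/\ I (c *: id_ + a *: e_ b) &
    sl_fin v (phi - (c *: id_ + a *: e_ b))].
  move=> Iphi; have /sum_scalarsP[c /glM_s0P fphi] := Igl _ Iphi.
  have slphi := sl_decomp b fphi; set a := trace _ in slphi.
  exists c, a; rewrite opprD addrA; split=> //.
  rewrite -[X in I X](subKr phi); apply: (subspaceB sI) => //.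
  by apply: slI; rewrite opprD addrA.
have nIae a : I (a *: e_ b) -> a = 0.
  move=> Iae; apply/eqP; apply: contraT => a0; exfalso; apply: nIe.
  by rewrite -[e_ b](scalerK a0); exact: (subspaceZ sI).
have [Iid|nIid] := pselect (I id_).
  constructor 2; apply/seteqP; split=> phi.
    move=> /IE[c [a [Ica slphi]]]; apply/sum_scalarsP; exists c.
    suff a0 : a = 0 by rewrite a0 scale0r addr0 in slphi.
    apply: nIae; rewrite -[_ *: _](addKr (c *: id_)) addrC.
    by apply: (subspaceB sI) => //; exact: (subspaceZ sI).
  move=> /sum_scalarsP[c /slI Iphi]; rewrite -[phi](subrK (c *: id_)).
  by apply: (subspaceD sI) => //; exact: (subspaceZ sI).
have nIcid c : I (c *: id_) -> c = 0.
  move=> Ic; apply/eqP; apply: contraT => c0; exfalso; apply: nIid.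
  by rewrite -[id_](scalerK c0); exact: (subspaceZ sI).
have [Isl|/existsNP[phi /not_implyP[Iphi nslphi]]] := pselect (I `<=` sl_fin v).
  by constructor 1; apply/seteqP.
have [c [a [Ica slphi]]] := IE _ Iphi.
have a0 : a != 0.
  apply/eqP => a0; move: Ica slphi; rewrite a0 scale0r addr0 => /nIcid ->.
  by rewrite scale0r subr0.
have c0 : c != 0.
  apply/eqP => c0; move: Ica slphi; rewrite c0 scale0r add0r => /nIae ->.
  by rewrite scale0r subr0.
(* The line through c id + a e_b, rescaled so that e_b has coefficient 1. *)
constructor 3; exists (a^-1 * c), b; split.
  by rewrite mulf_neq0 // invr_eq0.
have Ig : I ((a^-1 * c) *: id_ + e_ b).
  rewrite -[e_ b](scalerK a0) -scalerA -scalerDr; exact: (subspaceZ sI).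
apply/seteqP; split=> psi.
  move=> Ipsi; have [c' [a' [Ica' slpsi]]] := IE _ Ipsi.
  apply/shifted_slP; exists a'.
  suff ca : c' = a' * (a^-1 * c) by rewrite scalerDr scalerA -ca.
  apply/eqP; rewrite -subr_eq0; apply/eqP; apply: nIcid.
  rewrite scalerBl -scalerA.
  have -> : c' *: id_ - a' *: ((a^-1 * c) *: id_) =
      (c' *: id_ + a' *: e_ b) - a' *: ((a^-1 * c) *: id_ + e_ b).
    by rewrite scalerDr opprD [- _ - _]addrC addrA addrK.
  by apply: (subspaceB sI) => //; exact: (subspaceZ sI).
move=> /shifted_slP[d /slI Ipsi]; rewrite -[psi](subrK (d *: ((a^-1 * c) *:
  id_ + e_ b))).
by apply: (subspaceD sI) => //; exact: (subspaceZ sI).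
Qed.

Lemma ideal_classification I :
  [/\ is_ideal I, I <> [set 0] & I <> [set: glM v]] <->
  [\/ I = scalars v
   ,  I = sl_fin v
   ,  I = sumset (scalars v) (sl_fin v)
   |  [\/ exists (z : K) (b : B), z != 0 /\ I = shifted_sl v z b
       ,  exists s, (s <= t)%N /\ I = glM_s v s
       |  exists s, (s <= t)%N /\ I = sumset (scalars v) (glM_s v s)]].
Proof.
split=> [[idI I0 IT]|].
  have [sI _] := idI.
  have [Isc|/existsNP[phi /not_implyP[Iphi nphi]]] :=
    pselect (I `<=` scalars v).
    constructor 1; apply/seteqP; split=> //.
    have [phi Iphi phi0] : exists2 phi, I phi & phi <> 0.
      apply: contrapT => nI; apply: I0; apply/seteqP; split=> [phi Iphi|_ ->].
        by apply: contrapT => phi0; apply: nI; exists phi.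
      exact: (subspace0 sI).
    have /scalarsP[c phiE] := Isc _ Iphi.
    have c0 : c != 0 by apply/eqP => c0; apply: phi0; rewrite phiE c0 scale0r.
    move=> _ /scalarsP[d ->]; apply: (subspaceZ sI).
    by rewrite -[id_](scalerK c0); apply: (subspaceZ sI); rewrite -phiE.
  have slI := ideal_sl idI Iphi nphi.
  have [I_0|nI_0] := pselect (I `<=` sumset (scalars v) (glM_s v 0)).
    have [->|->|[z [b zI]]|[]->] := ideal_finite idI slI I_0.
    - by constructor 2.
    - by constructor 3.
    - by constructor 4; constructor 1; exists z, b.
    - by constructor 4; constructor 2; exists 0%N.
    - by constructor 4; constructor 3; exists 0%N.
  (* I lies in the sum at level t, being proper, but not in the one at level 0; s is a level where
     the inclusion begins to hold at the next step. *)
  have [s [st nIs Is]] : exists s, [/\ (s < t)%N,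
      ~ I `<=` sumset (scalars v) (glM_s v s) &
      I `<=` sumset (scalars v) (glM_s v s.+1)].
    have nIt : I `<=` sumset (scalars v) (glM_s v t).
      by apply: contrapT => /(ideal_notin_t idI).
    apply: contrapT => nex.
    suff nI s : (s <= t)%N -> ~ I `<=` sumset (scalars v) (glM_s v s) by exact:
      (nI t).
    elim: s => [//|s IHs] st Is; apply: nex; exists s; split=> //.
    exact: IHs (ltnW st).
  have [] := scalars_or_sum idI (glM_s_ideal st) (ideal_notin_lt st idI nIs) Is.
    by constructor 4; constructor 2; exists s.+1.
  by constructor 4; constructor 3; exists s.+1.
have [chi slchi chi0] := sl_neq0.
have [g0 _] := glM_s_ideal (leq0n t).
have sub_t s : (s <= t)%N -> sumset (scalars v) (glM_s v s) `<=`
    sumset (scalars v) (glM_s v t).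
  move=> st phi /sum_scalarsP[c gphi]; apply/sum_scalarsP; exists c.
  exact: (glM_s_mono st).
have gl0 s : (s <= t)%N -> glM_s v s 0.
  by move=> st; exact: (subspace0 (proj1 (glM_s_ideal st))).
case=> [->|->|->|[[z [b [z0 ->]]]|[s [st ->]]|[s [st ->]]]]; apply:
  listed_ideal.
- exact: scalars_ideal.
- by apply: sum_scalars_sub; exact: gl0.
- by exists id_; [apply/scalarsP; exists 1; rewrite scale1r|exact: id_neq0].
- exact: sl_fin_ideal.
- by apply: subset_trans (sub_t _ (leq0n t)); apply:
  subset_trans sl_sub_gl (@sum_sub _).
- by exists chi.
- by apply: submodule_sumset; [exact: bracket_linear|exact: scalars_ideal|exact:
  sl_fin_ideal].
- apply: subset_trans (sub_t _ (leq0n t)) =>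
  phi /sum_scalarsP[c /sl_sub_gl gphi].
  by apply/sum_scalarsP; exists c.
- by exists chi => //; exact: sum_sub.
- exact: shifted_sl_ideal.
- exact: subset_trans (@shifted_sl_gl z b) (sub_t _ (leq0n t)).
- by exists chi => //; exact: sl_shifted.
- exact: glM_s_ideal.
- exact: subset_trans (@sum_sub _) (sub_t _ st).
- by exists chi => //; apply: (glM_s_mono (leq0n s) st); exact: sl_sub_gl.
- by apply: submodule_sumset; [exact: bracket_linear|exact: scalars_ideal|exact:
  glM_s_ideal].
- exact: sub_t.
- exists chi => //; apply: sum_sub.
  by apply: (glM_s_mono (leq0n s) st); exact: sl_sub_gl.
Qed.

(** * The center and the socle filtration *)

Lemma glM_centerE : glM_center v = scalars v.
Proof.
apply/seteqP; split=> [phi cphi|_ /scalarsP[c ->] psi]; last first.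
  rewrite bracketE; apply: (glM_ext v_basis) => b.
  by rewrite glM_subE !glM_mulE !glM_scaleE linearZ /= subrr.
have [b _] := infinite_setN0 Binf.
apply/scalarsP; exists (x_ b (phi (v b))); apply: (glM_ext v_basis) => a.
(* At v_b, commutation with e_(a,b) says that phi(v_a) is v_a times the diagonal entry at b, a
   scalar that does not depend on a. *)
have := cphi (glM_unit v a b); rewrite bracketE => /(congr1 (fun f : glM v =>
  f (v b))).
rewrite glM_subE !glM_mulE glM_unit_basis // eqxx glM_unitE => /eqP.
by rewrite subr_eq0 => /eqP <-.
Qed.

(** A simple ideal not made of scalars contains sl, hence equals it; so the scalars and sl are the
    only simple ideals. *)
Lemma soc1E : soc (bracket v) 1 = sumset (scalars v) (sl_fin v).
Proof.
have simple_sl : simple_submodule (bracket v) (sl_fin v).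
  have [chi slchi chi0] := sl_neq0.
  split; [exact: sl_fin_ideal|by move=> sl0; rewrite sl0 in slchi|].
  move=> P idP Psl.
  have [Psc|/existsNP[phi /not_implyP[Pphi nphi]]] :=
    pselect (P `<=` scalars v).
    left; apply/seteqP; split=> [phi Pphi|_ ->]; last exact:
      (subspace0 (proj1 idP)).
    by rewrite -scalars_sl; split; [exact: Psc|exact: Psl].
  by right; apply/seteqP; split=> //; exact: ideal_sl idP Pphi nphi.
have simple_sc : simple_submodule (bracket v) (scalars v).
  split; first exact: scalars_ideal.
    move=> sc0; apply: id_neq0.
    suff : [set (0 : glM v)] id_ by [].
    by rewrite -sc0; apply/scalarsP; exists 1; rewrite scale1r.
  move=> P [sP _] Psc.
  have [P0|] := pselect (forall phi, P phi -> phi = 0).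
    by left; apply/seteqP; split=> [//|_ ->]; exact: (subspace0 sP).
  move=> /existsNP[phi /not_implyP[Pphi phi0]]; right.
  apply/seteqP; split=> // _ /scalarsP[d ->]; apply: (subspaceZ sP).
  have /scalarsP[c phiE] := Psc _ Pphi.
  have c0 : c != 0 by apply/eqP => c0; apply: phi0; rewrite phiE c0 scale0r.
  by rewrite -[id_](scalerK c0); apply: (subspaceZ sP); rewrite -phiE.
have [ssum _] := submodule_sumset bracket_linear scalars_ideal sl_fin_ideal.
rewrite -[LHS]/(socle (bracket v)) (socleE bracket_linear).
apply/seteqP; split.
  apply: (smallest_sub ssum) => phi [P [idP P0 minP] Pphi].
  have [Psc|/existsNP[psi /not_implyP[Ppsi npsi]]] :=
    pselect (P `<=` scalars v).
    by apply: sum_scalars_sub; [exact: (subspace0 (proj1 sl_fin_ideal))|exact: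
      Psc].
  have [] := minP _ sl_fin_ideal (ideal_sl idP Ppsi npsi).
    have [chi slchi chi0] := sl_neq0.
    by move=> sl0; rewrite sl0 in slchi.
  by move=> slP; rewrite -slP in Pphi; exact: sum_sub.
have sspan := subspace_span
  (\bigcup_(P in [set P | simple_submodule (bracket v) P]) P).
move=> _ [phi [psi [scphi slpsi ->]]]; apply: (subspaceD sspan).
  by apply: sub_gen_smallest; exists (scalars v).
by apply: sub_gen_smallest; exists (sl_fin v).
Qed.

(** The shift by two arises because soc^1 stops at sl; passing from sl to all finite rank operators
    takes a step of its own before the chain climbs one aleph at a time. *)
Lemma soc_glM_s s : (s <= t)%N ->
  soc (bracket v) s.+2 = sumset (scalars v) (glM_s v s).
Proof.
have idsum N : is_ideal N -> is_ideal (sumset (scalars v) N).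
  by apply: submodule_sumset; [exact: bracket_linear|exact: scalars_ideal].
have sum_subset N Q : is_ideal Q -> scalars v `<=` Q -> N `<=` Q ->
    sumset (scalars v) N `<=` Q.
  move=> [sQ _] scQ NQ _ [phi [psi [scphi Npsi ->]]].
  by apply: (subspaceD sQ); [exact: scQ|exact: NQ].
elim: s => [_|s IHs st].
  rewrite -[LHS]/(quot_proj (soc (bracket v) 1) @^-1`
    socle (@quot_act _ _ _ (bracket v) (soc (bracket v) 1))) soc1E.
  have [b _] := infinite_setN0 Binf.
  apply: (socle_quot bracket_linear).
  - exact: idsum sl_fin_ideal.
  - exact: idsum (glM_s_ideal (leq0n t)).
  - move=> phi /sum_scalarsP[c /sl_sub_gl gphi]; apply/sum_scalarsP.
    by exists c.
  - move=> sub; apply: (@unit_notin b); apply: sub; apply: sum_sub; exact: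
    unit_gl.
  move=> Q idQ NQ nQN.
  have scQ : scalars v `<=` Q.
    apply: subset_trans NQ; apply: sum_scalars_sub.
    exact: (subspace0 (proj1 sl_fin_ideal)).
  have slQ : sl_fin v `<=` Q by apply: subset_trans NQ; exact: sum_sub.
  apply: sum_subset => //.
  (* If Q leaves the scalars plus finite rank operators, the gap lemma applies. Otherwise Q
     contains, up to a scalar, an operator of nonzero trace, which yields e_b modulo sl. *)
  have [Qgl|nQgl] := pselect (Q `<=` sumset (scalars v) (glM_s v 0)); last
    first.
    exact: ideal_notin nQgl.
  move: nQN => /existsNP[phi /not_implyP[Qphi nphi]].
  have /sum_scalarsP[c /glM_s0P fphi] := Qgl _ Qphi.
  have [sQ _] := idQ.
  have tr0 : trace (phi - c *: id_) != 0.
    apply/eqP => tr0; apply: nphi; apply/sum_scalarsP; exists c.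
    by apply/(sl_finP v_basis).
  apply: (@ideal_gl0 _ b) => //.
  rewrite -[e_ b](scalerK tr0); apply: (subspaceZ sQ).
  rewrite -[X in Q X](subKr (phi - c *: id_)).
  apply: (subspaceB sQ); last by apply: slQ; exact: sl_decomp.
  by apply: (subspaceB sQ) => //; apply: scQ; apply/scalarsP; exists c.
rewrite -[LHS]/(quot_proj (soc (bracket v) s.+2) @^-1`
  socle (@quot_act _ _ _ (bracket v) (soc (bracket v) s.+2))) (IHs (ltnW st)).
apply: (socle_quot bracket_linear).
- exact: idsum (glM_s_ideal (ltnW st)).
- exact: idsum (glM_s_ideal st).
- move=> phi /sum_scalarsP[c gphi]; apply/sum_scalarsP.
  by exists c; exact: (glM_s_mono (leqnSn s) st).
- move=> sub; apply: (glM_s_lt st); apply: subset_trans sub; exact: sum_sub.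
move=> Q idQ NQ nQN; apply: sum_subset => //; last exact: ideal_notin_lt.
apply: subset_trans NQ; apply: sum_scalars_sub.
exact: (subspace0 (proj1 (glM_s_ideal (ltnW st)))).
Qed.

End Classification.

Theorem theorem2p8 (R : realType) (t : nat) (B : choiceType) (V : lmodType R[i])
    (v : B -> V) (v_basis : is_basis v) (card_B : has_card_aleph t [set: B]) :
  (* the complete list *)
  (forall I : set (glM v),
     [/\ is_ideal I, I <> [set 0] & I <> [set: glM v]] <->
     [\/ I = scalars v
      ,  I = sl_fin v
      ,  I = sumset (scalars v) (sl_fin v)
      |  [\/ exists (z : R[i]) (b : B), z != 0 /\ I = shifted_sl v z b
          ,  exists s, (s <= t)%N /\ I = glM_s v s
          |  exists s, (s <= t)%N /\ I = sumset (scalars v) (glM_s v s)]])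
  /\
  [/\ (* (i) *)
      glM_center v = scalars v,
      (* (iii) *)
      scalars v `&` sl_fin v = [set 0] /\
      sumset (scalars v) (sl_fin v) = soc (bracket v) 1,
      (* (iv) *)
      (forall (z : R[i]) (b : B), z != 0 -> shifted_sl v z b `<=` soc (bracket v) 2) /\
      (forall (z : R[i]) (b b' : B), z != 0 -> shifted_sl v z b = shifted_sl v z b'),
      (* (v) *)
      (forall s, (s <= t)%N -> glM_s v s `<=` soc (bracket v) (s + 2)) /\
      glM_s v 0 = gl_fin v
    & (* (vi) *)
      forall s, (s <= t)%N ->
        scalars v `&` glM_s v s = [set 0] /\
        sumset (scalars v) (glM_s v s) = soc (bracket v) (s + 2)].
Proof.
have char2 : 2 != 0 :> R[i] by rewrite Num.Theory.pnatr_eq0.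
split; first by move=> I; exact: ideal_classification.
split.
- exact: (glM_centerE v_basis card_B).
- split; first exact: (scalars_sl v_basis card_B).
  by rewrite (soc1E v_basis char2 card_B).
- split=> [z b z0|z b b' z0].
    rewrite (soc_glM_s v_basis char2 card_B (leq0n t)).
    exact: (shifted_sl_gl v_basis card_B).
  by apply/seteqP; split; exact: (shifted_sl_indep v_basis card_B).
- split=> [s st|]; last exact: (glM_s0 v_basis card_B).
  by rewrite addn2 (soc_glM_s v_basis char2 card_B st); exact: sum_sub.
- move=> s st; split; first exact: (scalars_glM_s v_basis card_B st).
  by rewrite addn2 (soc_glM_s v_basis char2 card_B st).
Qed.
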